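(* Let $d\ge1$ and let $W:\mathbb{R}^d\to\mathbb{R}\cup\{+\infty\}$ be symmetric ($W(-x)=W(x)$ for all $x$), lower semicontinuous, bounded from below by a finite constant and locally integrable. Suppose that $W$ is $\beta$-repulsive with $0<\beta<d$ and that $\Delta^0W\le C_W$ on $\mathbb{R}^d$ for some $C_W>0$. Then there is a constant $C'>0$, depending only on $W$, such that for every $N\ge2$ and every minimiser $\boldsymbol{X}\in\mathbb{R}^{Nd}$ of the discrete interaction energy $E_N$ one has $\boldsymbol{X}\in\mathcal{M}_p^N$ with $p=d/(d-\beta)$ and $[\boldsymbol{X}]_{\mathcal{M}_p^N}\le C'$.
   Context: $B_R(z)$ is the open ball of radius $R$ and centre $z$, $B_R:=B_R(0)$. For $\boldsymbol{X}=(x_1,\dots,x_N)\in\mathbb{R}^{Nd}$, $E_N(\boldsymbol{X})=\frac{1}{2N^2}\sum_{i=1}^N\sum_{j\ne i}W(x_i-x_j)$; a minimiser is a global minimiser on $\mathbb{R}^{Nd}$. The empirical measure is $\mu_{\boldsymbol{X}}=\frac1N\sum_{i=1}^N\delta_{x_i}$. Generalised Laplacian: $\Delta^\varepsilon W(x)=\frac{2(d+2)}{\varepsilon^2}\left(\frac{1}{|B_\varepsilon|}\int_{B_\varepsilon}W(x+y)\,dy-W(x)\right)$ for $\varepsilon>0$ (equal to $-\infty$ if $W(x)=+\infty$), and $\Delta^0W(x)=\liminf_{\varepsilon\to0}\Delta^\varepsilon W(x)\in[-\infty,+\infty]$. $W$ is $\beta$-repulsive if it is locally integrable and there exist $\delta>0$,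 $C>0$ with $-\Delta^0W(x)\ge C|x|^{-\beta}$ for all $0<|x|<\delta$ and $-\Delta^0W(0)=+\infty$. Empirical Morrey measures: for $p\in[1,\infty]$ with Hölder dual $q$ ($1/p+1/q=1$) and $\boldsymbol{X}\in\mathbb{R}^{Nd}$, let $m_{i,r}(\boldsymbol{X})=\mu_{\boldsymbol{X}}(B_r(x_i))-\frac1N$. We write $\boldsymbol{X}\in\mathcal{M}_p^N$ if there is $M>0$ with $m_{i,r}(\boldsymbol{X})\le Mr^{d/q}$ for all $r>0$ and $i\in\{1,\dots,N\}$, and $[\boldsymbol{X}]_{\mathcal{M}_p^N}=\sup_{r>0,\,1\le i\le N}r^{-d/q}m_{i,r}(\boldsymbol{X})$. (For $p=d/(d-\beta)$ one has $d/q=\beta$.) *)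

(* Defs.v *)
From HB Require Import structures.
From mathcomp Require Import all_boot all_order all_algebra.
From mathcomp Require Import all_classical all_reals all_analysis.
From mathcomp Require Import measurable_realfun.

Set Implicit Arguments.
Unset Strict Implicit.
Unset Printing Implicit Defensive.

Import Order.TTheory GRing.Theory Num.Theory.
Import numFieldNormedType.Exports.

Local Open Scope classical_set_scope.
Local Open Scope ring_scope.

Fact borel_rV_display : measure_display.
Proof. exact: default_measure_display. Qed.

Section borel_rV.
Context {R : realType} (n : nat).

Definition borel_rV : set (set 'rV[R]_n) := <<s open >>.

Let borel0 : borel_rV set0.
Proof. exact: sigma_algebra0. Qed.

Let borelC A : borel_rV A -> borel_rV (~` A).
Proof. exact: sigma_algebraC. Qed.

Let borelU (F : (set 'rV[R]_n)^nat) :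
  (forall i, borel_rV (F i)) -> borel_rV (\bigcup_i F i).
Proof. exact: sigma_algebra_bigcup. Qed.

HB.instance Definition _ := @isMeasurable.Build borel_rV_display 'rV[R]_n
  borel_rV borel0 borelC borelU.

Lemma open_measurable_rV (U : set 'rV[R]_n) : open U -> measurable U.
Proof. exact: sub_sigma_algebra. Qed.

Lemma measurable_coord (i : 'I_n) :
  measurable_fun [set: 'rV[R]_n] (fun x => x ord0 i).
Proof.
apply: (measurability _ (RGenOpens.measurableE R)) => _ [_ [a [b ->]] <-].
rewrite setTI; apply: open_measurable_rV.
by apply: open_comp; [move=> x _; exact: coord_continuous|exact: interval_open].
Qed.

Lemma measurable_fun_rV d (T : measurableType d) (f : T -> 'rV[R]_n) :
  (forall i, measurable_fun setT (fun t => f t ord0 i)) ->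
  measurable_fun setT f.
Proof.
move=> mf; apply: (@measurability _ _ _ _ _ f open) => // _ [U oU <-].
rewrite setTI.
pose c (q : {ffun 'I_n -> rat}) : 'rV[R]_n := \row_i ratr (q i).
pose e (k : nat) : R := k.+1%:R^-1.
pose I : set ({ffun 'I_n -> rat} * nat) :=
  [set p | ball (c p.1) (e p.2) `<=` U].
have -> : f @^-1` U = \bigcup_(p in I) f @^-1` ball (c p.1) (e p.2).
  apply/seteqP; split => [t Ut|t [p pI]]; last exact: pI.
  have /nbhs_ballP[r /= r0 rU] : nbhs (f t) U by exact: open_nbhs_nbhs.
  have [k /= kr] : exists k, e k < r / 2.
    have r20 : 0 < r / 2 by rewrite divr_gt0.
    have [k _ /(_ k (leqnn k)) ?] := near_infty_natSinv_lt (PosNum r20).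
    by exists k.
  have ek0 : 0 < e k by rewrite invr_gt0.
  have qP (i : 'I_n) : exists q : rat, `|f t ord0 i - ratr q| < e k.
    have [|q] := @rat_in_itvoo R (f t ord0 i - e k) (f t ord0 i + e k).
      by rewrite ltrD2l gtrN.
    rewrite in_itv/= => /andP[lq qr]; exists q.
    by rewrite ltr_distlC lq qr.
  have [q qE] := choice qP.
  have cft : ball (c [ffun i => q i]) (e k) (f t).
    rewrite /ball/=; split => // i j.
    by rewrite /ball/= ord1 !mxE ffunE distrC; exact: qE.
  exists ([ffun i => q i], k) => //= v cv; apply: rU.
  have -> : r = r / 2 + r / 2 by rewrite -splitr.
  apply: (@ball_triangle _ _ (c [ffun i => q i])).
    by apply: ball_sym; apply: le_ball cft; exact: ltW.
  by apply: le_ball cv; exact: ltW.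
rewrite bigcup_mkcond; apply: countable_bigcupT_measurable => [|p].
  exact: countableP.
case: ifPn => // _.
have -> : f @^-1` ball (c p.1) (e p.2) =
  \bigcap_(i in [set: 'I_n]) (fun t => f t ord0 i) @^-1` ball (c p.1 ord0 i) (e p.2).
  apply/seteqP; split => [t [_ bt] i _|t bt]; first exact: bt.
  split; first by rewrite invr_gt0.
  by move=> i j; rewrite ord1; exact: bt.
apply: fin_bigcap_measurable => // i _.
rewrite -[X in measurable X]setTI; apply: mf => //.
exact: measurable_ball.
Qed.

End borel_rV.

Definition row_cons (R : realType) n (p : measurableTypeR R * 'rV[R]_n) : 'rV[R]_n.+1 :=
  \row_i if unlift ord0 i is Some j then p.2 ord0 j else p.1.

Lemma measurable_row_cons (R : realType) n :
  measurable_fun setT (@row_cons R n).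
Proof.
apply: measurable_fun_rV => i.
case: (unliftP ord0 i) => [j ->|->].
  have -> : (fun p : measurableTypeR R * 'rV[R]_n => row_cons p ord0 (lift ord0 j)) =
      (fun x : 'rV[R]_n => x ord0 j) \o snd.
    by apply/funext => p /=; rewrite mxE liftK.
  by apply: measurableT_comp => //; exact: measurable_coord.
have -> : (fun p : measurableTypeR R * 'rV[R]_n => row_cons p ord0 ord0) = fst.
  by apply/funext => p /=; rewrite mxE unlift_none.
exact: measurable_fst.
Qed.

Definition row_uncons (R : realType) n (x : 'rV[R]_n.+1) : measurableTypeR R * 'rV[R]_n :=
  (x ord0 ord0, \row_i x ord0 (lift ord0 i)).

Lemma row_consK (R : realType) n : cancel (@row_cons R n) (@row_uncons R n).
Proof.
move=> [a v]; rewrite /row_uncons /row_cons mxE unlift_none /=; congr pair.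
by apply/rowP => i; rewrite !mxE liftK.
Qed.

Lemma measurable_row_uncons (R : realType) n :
  measurable_fun setT (@row_uncons R n).
Proof.
apply: measurable_fun_pair; first exact: measurable_coord.
apply: measurable_fun_rV => i.
have -> : (fun x : 'rV[R]_n.+1 => (row_uncons x).2 ord0 i) =
    (fun x => x ord0 (lift ord0 i)) by apply/funext => x; rewrite mxE.
exact: measurable_coord.
Qed.

Section lebesgue_rV_step.
Context {R : realType} (n : nat).
Variable mu : {sigma_finite_measure set 'rV[R]_n -> \bar R}.
Let mcons := @measurable_row_cons R n.

Definition lebesgue_rV_step : set 'rV[R]_n.+1 -> \bar R :=
  pushforward (@lebesgue_measure R \x mu)%E (@row_cons R n).

Let step0 : lebesgue_rV_step set0 = 0%E.
Proof. exact: measure0. Qed.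

Let step_ge0 A : (0 <= lebesgue_rV_step A)%E.
Proof. exact: measure_ge0. Qed.

Let step_sigma_additive : semi_sigma_additive lebesgue_rV_step.
Proof. exact: measure_semi_sigma_additive. Qed.

HB.instance Definition _ := isMeasure.Build _ _ _ lebesgue_rV_step
  step0 step_ge0 step_sigma_additive.

Let step_sigma_finite : sigma_finite setT lebesgue_rV_step.
Proof.
have /sigma_finiteP[F [FT ndF Foo]] := sigma_finiteT (@lebesgue_measure R).
have /sigma_finiteP[G [GT ndG Goo]] := sigma_finiteT mu.
exists (fun k => @row_uncons R n @^-1` (F k `*` G k)).
  apply/esym; rewrite -subTset => x _.
  have [i _ Fi] : (\bigcup_i F i) (row_uncons x).1 by rewrite -FT.
  have [j _ Gj] : (\bigcup_i G i) (row_uncons x).2 by rewrite -GT.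
  exists (maxn i j) => //; split.
    by move: Fi; exact/subsetPset/ndF/leq_maxl.
  by move: Gj; exact/subsetPset/ndG/leq_maxr.
move=> k; have [mF Fk] := Foo k; have [mG Gk] := Goo k; split.
  rewrite -[X in measurable X]setTI.
  by apply: measurable_row_uncons => //; exact: measurableX.
rewrite /lebesgue_rV_step /pushforward -comp_preimage.
have -> : @row_uncons R n \o @row_cons R n = id.
  by apply/funext => x /=; rewrite row_consK.
by rewrite preimage_id product_measure1E// lte_mul_pinfty// ge0_fin_numE.
Qed.

HB.instance Definition _ := Measure_isSigmaFinite.Build _ _ _ lebesgue_rV_step
  step_sigma_finite.

End lebesgue_rV_step.

(* Lebesgue measure on the Borel sets of R^n, built by iterated products;
   lebesgue_rV_box gives its value on boxes, which determines it. *)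
Fixpoint lebesgue_rV (R : realType) (n : nat) :
    {sigma_finite_measure set 'rV[R]_n -> \bar R} :=
  if n isn't m.+1 then [the {sigma_finite_measure set 'rV[R]_0 -> \bar R} of
    \d_(0 : 'rV[R]_0)]
  else [the {sigma_finite_measure set 'rV[R]_m.+1 -> \bar R} of
    lebesgue_rV_step (lebesgue_rV R m)].

Lemma measurable_box (R : realType) (n : nat) (A : 'I_n -> set R) :
  (forall i, measurable (A i)) ->
  measurable [set x : 'rV[R]_n | forall i, A i (x ord0 i)].
Proof.
move=> mA; have -> : [set x : 'rV[R]_n | forall i, A i (x ord0 i)] =
    \bigcap_(i in [set: 'I_n]) (fun x : 'rV[R]_n => x ord0 i) @^-1` A i.
  by apply/seteqP; split => x /= Ax i; [move=> _|]; exact: Ax.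
apply: fin_bigcap_measurable => // i _.
by rewrite -[X in measurable X]setTI; apply: measurable_coord => //; exact: mA.
Qed.

Lemma lebesgue_rV_box (R : realType) (n : nat) (A : 'I_n -> set R) :
  (forall i, measurable (A i)) ->
  lebesgue_rV R n [set x : 'rV[R]_n | forall i, A i (x ord0 i)] =
  (\prod_(i < n) @lebesgue_measure R (A i))%E.
Proof.
elim: n A => [|n IHn] A mA.
  rewrite big_ord0 /= diracE mem_set// => i; by case: i.
rewrite big_ord_recl /= /lebesgue_rV_step /pushforward.
rewrite -IHn => [|i]; last exact: mA.
rewrite -product_measure1E//.
  congr (product_measure1 _ _ _); apply/seteqP; split => -[a v] /=.
    move=> Aav; split => [|i].
      by have := Aav ord0; rewrite mxE unlift_none.
    by have := Aav (lift ord0 i); rewrite mxE liftK.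
  move=> [Aa Av] i; rewrite mxE.
  by case: (unliftP ord0 i) => [j ->|->]; [exact: Av|].
  exact: mA.
by apply: (@measurable_box _ _ (fun i => A (lift ord0 i))) => i; exact: mA.
Qed.

Section potential.
Context {R : realType} {d : nat}.
Implicit Types (x z : 'rV[R]_d) (W : 'rV[R]_d -> \bar R) (beta eps : R).

(* The norm `|x| that MathComp-Analysis puts on row vectors is the sup norm;
   it is used below only through the topology that it induces. *)
Definition enorm x : R := Num.sqrt (\sum_(i < d) x ord0 i ^+ 2).

Definition eball z (r : R) : set 'rV[R]_d := [set x | enorm (x - z) < r].

(* Potentials with values in R u {+oo} are functions into \bar R that are
   bounded below by a real constant. *)
Definition locally_integrable_rV W : Prop :=
  measurable_fun [set: 'rV[R]_d] W /\
  forall K : set 'rV[R]_d, compact K ->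
    (\int[lebesgue_rV R d]_(x in K) `|W x| < +oo)%E.

Definition ball_average W x eps : \bar R :=
  ((lebesgue_rV R d (eball 0 eps))^-1 *
   \int[lebesgue_rV R d]_(y in eball 0 eps) W (x + y)%R)%E.

Definition laplacian_eps eps W x : \bar R :=
  if W x == +oo%E then -oo%E
  else ((2 * (d%:R + 2) / eps ^+ 2)%:E * (ball_average W x eps - W x))%E.

Definition laplacian0 W x : \bar R :=
  limf_einf (fun eps => laplacian_eps eps W x) 0^'+.

Definition repulsive beta W : Prop :=
  locally_integrable_rV W /\
  exists delta C : R, [/\ 0 < delta, 0 < C,
    forall x, 0 < enorm x < delta ->
      ((C * enorm x `^ (- beta))%:E <= - laplacian0 W x)%E &
    (- laplacian0 W 0 = +oo)%E].

End potential.

Section particles.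
Context {R : realType} {d N : nat}.
Implicit Types (X Y : 'I_N -> 'rV[R]_d) (W : 'rV[R]_d -> \bar R).

Definition energy W X : \bar R :=
  ((2 * N%:R ^+ 2)^-1%:E *
   \sum_(i < N) \sum_(j < N | j != i) W (X i - X j)%R)%E.

Definition minimiser W X : Prop := forall Y, (energy W X <= energy W Y)%E.

Definition empirical_measure X (A : set 'rV[R]_d) : \bar R :=
  (N%:R^-1%:E * \sum_(i < N) \d_(X i) A)%E.

Definition morrey_mass X (i : 'I_N) (r : R) : \bar R :=
  (empirical_measure X (eball (X i) r) - N%:R^-1%:E)%E.

(* d / q for the Hoelder dual q of p, where p is in [1, +oo]; it is 0 when
   p = 1, that is, q = +oo. *)
Definition morrey_exponent (p : \bar R) : R :=
  fine (d%:R%:E / hoelder_conjugate p)%E.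

Definition morrey (p : \bar R) X : Prop :=
  exists2 M : R, 0 < M & forall (r : R) (i : 'I_N), 0 < r ->
    (morrey_mass X i r <= (M * r `^ morrey_exponent p)%:E)%E.

Definition morrey_norm (p : \bar R) X : \bar R :=
  ereal_sup [set m | exists (r : R) (i : 'I_N),
    0 < r /\ m = ((r `^ (- morrey_exponent p))%:E * morrey_mass X i r)%E].

End particles.

Lemma morrey_exponentE (R : realType) (d : nat) (beta : R) : 0 < beta < d%:R ->
  @morrey_exponent R d (d%:R / (d%:R - beta))%:E = beta.
Proof.
move=> /andP[b0 bd]; have d0 : 0 < d%:R :> R := lt_trans b0 bd.
have db : d%:R - beta != 0 by rewrite subr_eq0 gt_eqF.
set p : R := _ / _.
have p1 : p - 1 = beta / (d%:R - beta) by rewrite /p -[X in _ - X](divff db) -mulrBl opprB addrC subrK.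
have p0 : p != 0 by rewrite mulf_neq0 ?invr_eq0 ?(gt_eqF d0).
have q : hoelder_conjugate p%:E = (d%:R / beta)%:E.
  rewrite /hoelder_conjugate /= eqe (negbTE p0) -EFinD p1 inver.
  rewrite mulf_eq0 invr_eq0 (negbTE db) gt_eqF//= -EFinM.
  by rewrite /p invf_div mulrA divfK.
rewrite /morrey_exponent q inver mulf_eq0 invr_eq0 !gt_eqF//= invf_div mulrC divfK// gt_eqF//.
Qed.

(* Main.v *)
(* Fix a particle [X_i], put [z_j = X_i - X_j] and let [n] be the number of
   particles at distance less than [r] from it.  By minimality,
   [sum_j W (z_j + y) >= sum_j W z_j] for all [y], all terms on the right being
   finite.  The bounds on [laplacian0 W] are pointwise limits inferior, which do
   not add up over [j] along a common sequence of radii, so each term is first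
   compared with a harmonic function: on the sphere [|y| = r], choose polynomials
   [g_j <= W (z_j + .)] with [sum_j g_j >= sum_j W z_j - e] (inf-convolutions,
   Dini's argument and Bernstein polynomials) and extend them to harmonic
   polynomials [h_j].  A minimum of [W (z_j + .) - h_j - A |.|^2] inside the ball
   would contradict the bound on [laplacian0 W], whence
   [h_j 0 <= W z_j + A_j r^2], with [A_j] of order [C_W] in general and of order
   [- r^(- beta)] if [|z_j| < r].  The minimum principle gives
   [sum_j h_j 0 >= sum_j W z_j - e], so [sum_j A_j >= 0], that is,
   [n r^(- beta) <= const * N]. *)
Require Import Defs.
From mathcomp Require Import all_boot all_order all_fingroup all_algebra ring lra.
From mathcomp Require mpoly.

Set Implicit Arguments.
Unset Strict Implicit.
Unset Printing Implicit Defensive.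

Import Order.TTheory GRing.Theory Num.Theory.

Local Open Scope ring_scope.

(** * Harmonic extension of polynomials from spheres *)

(** Polynomial boundary data turn the Dirichlet problem on a sphere into algebra, and the harmonic
    extensions can all be compared at the single radius [r], where they add up. The ball averages
    enter only through the second moments of balls, bounded by [moment_cst e^2 |B_e|] from below and
    [e^2 |B_e|] from above. The exact value [e^2 |B_e| / (d + 2)] would reproduce the Laplacian of a
    quadratic polynomial; the two bounds cost a factor that depends on [d] and on the sign of the
    trace [t]. Hence the minimum of [t] and [moment_cst * t] in the estimates; it affects only the
    final constant. The comparison sphere has the radius [r] of the counting ball: if [|z_j| < r]
    and [|y| < r], then [z_j + y] is within [2 r] of the origin, so one bound [- C (2 r)^(- beta)]
    holds on the whole ball. Gain and loss are both multiples of [r^2], which cancels. Radii with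
    [2 r > delta] are left to the trivial bound: the mass is at most 1. *)

Definition sqnorm (R : nzRingType) n (x : 'rV[R]_n) : R := \sum_i x ord0 i ^+ 2.

(* For smooth [f], [b] is the gradient and [t] half the Laplacian of [f] at [x]. *)
Definition jet2 (R : numDomainType) n (f : 'rV[R]_n -> R) (x : 'rV[R]_n)
    (b : 'I_n -> R) (t : R) : Prop :=
  exists H : 'M[R]_n, exists M : R, [/\ \tr H = t, 0 <= M &
    forall (e : R) (y : 'rV[R]_n), 0 <= e <= 1 ->
      (forall i, `|y ord0 i| <= e) ->
      `|f (x + y) - (f x + \sum_i b i * y ord0 i +
          \sum_i \sum_j H i j * (y ord0 i * y ord0 j))| <= M * e ^+ 3].

Module PolynomialFunctions.
Import mpoly.

Section Evaluation.
Context {R : realFieldType} {n : nat}.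
Implicit Types (p q h : {mpoly R[n]}) (x : 'rV[R]_n).

Definition peval p x : R := p.@[fun i => x ord0 i].

(** A predicate on functions, so that the analytic part never handles [mpoly] terms. *)
Definition polyfun (f : 'rV[R]_n -> R) := exists p, f = peval p.

Lemma polyfun_cst c : polyfun (fun=> c).
Proof.
exists c%:MP; apply/boolp.funext => x; by rewrite /peval mevalC.
Qed.

Lemma polyfun_coord i : polyfun (fun x => x ord0 i).
Proof. by exists 'X_i; apply/boolp.funext => x; rewrite /peval mevalXU. Qed.

Lemma polyfunD f g : polyfun f -> polyfun g -> polyfun (fun x => f x + g x).
Proof.
move=> [p ->] [q ->]; exists (p + q); apply/boolp.funext => x.
by rewrite /peval mevalD.
Qed.

Lemma polyfunM f g : polyfun f -> polyfun g -> polyfun (fun x => f x * g x).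
Proof.
move=> [p ->] [q ->]; exists (p * q); apply/boolp.funext => x.
by rewrite /peval mevalM.
Qed.

(** A monomial is an iterated product of variables, so multiplication by one [X_i] is the only
    product that the harmonic extension and the second-order expansion have to treat. *)
Lemma mpoly_ring_ind (P : {mpoly R[n]} -> Prop) :
  (forall c, P c%:MP) -> (forall p q, P p -> P q -> P (p + q)) ->
  (forall c p, P p -> P (c *: p)) ->
  (forall i p, P p -> P ('X_i * p)) -> forall p, P p.
Proof.
move=> PC PD PZ PX; elim/mpolyind => [|c m p _ _ Pp]; first by rewrite -mpolyC0.
apply: PD => //; apply: PZ; rewrite mpolyXE_id.
elim: (index_enum _) => [|i s IHs]; first by rewrite big_nil -mpolyC1.
rewrite big_cons; elim: (m i) => [|k IHk]; first by rewrite expr0 mul1r.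
by rewrite exprS -mulrA; exact: PX.
Qed.

Definition lap p := \sum_(i < n) p^`M(i)^`M(i).
(** The Euler operator [x . grad], which is the cross term in the Laplacian of [|x|^2 q]. *)
Definition eul p := \sum_(i < n) 'X_i * p^`M(i).
Definition sqX : {mpoly R[n]} := \sum_(i < n) 'X_i ^+ 2.

Lemma lapD p q : lap (p + q) = lap p + lap q.
Proof. by rewrite /lap -big_split; apply: eq_bigr => i _; rewrite !mderivD. Qed.

Lemma lapZ c p : lap (c *: p) = c *: lap p.
Proof. by rewrite /lap scaler_sumr; apply: eq_bigr => i _; rewrite !mderivZ. Qed.

Lemma mderivXU (i j : 'I_n) : ('X_j : {mpoly R[n]})^`M(i) = (i == j)%:R.
Proof.
rewrite mderivX mnm1E eq_sym; case: eqP => [->|_]; last by rewrite scale0r.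
rewrite scale1r (_ : (_ - _)%MM = 0%MM) ?mpolyX0//.
by apply/mnmP => k; rewrite mnmBE subnn mnm0E.
Qed.

Lemma lapXM i p : lap ('X_i * p) = 2%:R *: p^`M(i) + 'X_i * lap p.
Proof.
rewrite /lap mulr_sumr.
rewrite (eq_bigr (fun j => (i == j)%:R * (p^`M(j) *+ 2) +
   'X_i * p^`M(j)^`M(j))); last first.
  move=> j _; rewrite mderivM mderivXU mderivD !mderivM mderivXU eq_sym.
  case: eqP => _; first by rewrite (mderivC _ 1) !mul1r mul0r mulr2n; ring.
  by rewrite !mul0r mderiv0 mul0r !add0r.
rewrite big_split/=; congr (_ + _).
rewrite (bigD1 i)//= eqxx mul1r big1 ?addr0 ?scaler_nat// => j.
by rewrite eq_sym => /negbTE ->; rewrite mul0r.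
Qed.

Lemma mderiv_sqX i : sqX^`M(i) = 2%:R *: 'X_i.
Proof.
rewrite /sqX raddf_sum (bigD1 i)//= big1 ?addr0 => [|j ji].
  by rewrite mderivM mderivXU eqxx mul1r mulr1 scaler_nat mulr2n.
by rewrite mderivM mderivXU eq_sym (negbTE ji) mul0r mulr0 addr0.
Qed.

Lemma lap_sqXM q : lap (sqX * q) = (2 * n%:R) *: q + 4%:R *: eul q + sqX * lap q.
Proof.
rewrite /lap /eul mulr_sumr scaler_sumr.
have -> : (2 * n%:R) *: q = \sum_(i < n) 2%:R *: q.
  by rewrite sumr_const card_ord -scaler_nat scalerA mulrC.
rewrite -!big_split /=; apply: eq_bigr => i _.
rewrite mderivM mderivD !mderivM mderiv_sqX mderivZ mderivXU eqxx.
rewrite !scaler_nat mulr1n; ring.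
Qed.

Lemma eul_homog k p : p \is k.-homog -> eul p = k%:R *: p.
Proof.
move=> /dhomogP pk; rewrite [in RHS](mpolyE p) [in LHS](mpolyE p) /eul.
under eq_bigr do rewrite raddf_sum mulr_sumr.
rewrite exchange_big/= scaler_sumr big_seq [RHS]big_seq.
apply: eq_bigr => m mp; rewrite -(pk _ mp) /= mdegE natr_sum scaler_suml.
apply: eq_bigr => i _; rewrite mderivZ mderivX -!scalerAr scalerA mulrC -scalerA.
(* If [m i = 0], the truncated subtraction of [U_(i)] is not undone by adding [U_(i)] back, but the
   coefficient vanishes. *)
have [->|mi] := eqVneq (m i) 0%N; first by rewrite !scale0r.
congr (_ *: (_ *: _)); rewrite -mpolyXD; congr mpolyX; apply/mnmP => j.
rewrite mnmDE mnmBE mnm1E; case: eqP => [<-|_] /=; last by rewrite add0n subn0.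
by rewrite addnC subnK// lt0n.
Qed.

Lemma mderiv_homog k p i : p \is k.+1.-homog -> p^`M(i) \is k.-homog.
Proof.
move=> /dhomogP pk; apply/dhomogP => m; rewrite mcoeff_msupp mcoeff_mderiv.
move=> m0; have : (m + U_(i))%MM \in msupp p.
  by rewrite mcoeff_msupp; apply: contra_neq m0 => ->; rewrite mul0rn.
by move=> /pk /=; rewrite mdegD mdeg1 addn1 => -[].
Qed.

Definition hharm h := exists2 k, h \is k.-homog & lap h = 0.

Lemma lap_mderiv i p : lap p = 0 -> lap p^`M(i) = 0.
Proof.
move=> p0; rewrite -(mderiv0 _ i) -p0 /lap raddf_sum /=.
by apply: eq_bigr => j _; rewrite [p^`M(i)^`M(j)]mderiv_comm mderiv_comm.
Qed.

(* The correction that makes [X_i h] harmonic is a multiple of [|x|^2 d_i h],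
   which on the sphere is again harmonic. *)
Lemma hharmXM i h : hharm h ->
  exists c, hharm h^`M(i) /\ hharm ('X_i * h - c *: (sqX * h^`M(i))).
Proof.
move=> [k hk h0].
have X1 j : ('X_j : {mpoly R[n]}) \is 1.-homog by rewrite dhomogX /= mdeg1.
have S2 : sqX \is 2.-homog.
  by rewrite rpred_sum// => j _; exact: (dhomogM (X1 j) (X1 j)).
case: k hk => [|k] hk.
  have hi : h^`M(i) = 0.
    apply/mpolyP => m; rewrite mcoeff_mderiv mcoeff0.
    rewrite (dhomog_nemf_coeff hk) ?mul0rn//=.
    by rewrite mdegD mdeg1 addn1.
  exists 0; rewrite hi scale0r subr0; split.
    by exists 0%N; [exact: dhomog0|rewrite -[in lap _](scale0r 0) lapZ scale0r].
  by exists (1 + 0)%N; [exact: dhomogM (X1 i) hk|rewrite lapXM hi h0 scaler0 mulr0 addr0].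
have hik := mderiv_homog i hk.
have li := lap_mderiv i h0.
(* The derivative [d_i h] is harmonic and [k]-homogeneous, so the Laplacian of [X_i h] is [2 d_i h]
   and that of [|x|^2 d_i h] is [(2 n + 4 k) d_i h]; the constant is their ratio. *)
exists (n%:R + 2 * k%:R)^-1; split; first by exists k.
exists k.+2; last first.
  rewrite -scaleNr lapD lapZ lapXM lap_sqXM h0 li !mulr0 !addr0.
  rewrite (eul_homog hik) scalerA -scalerDl scalerA -scalerDl.
  set c : R := _ + _; suff -> : c = 0 by rewrite scale0r.
  have n0 : n%:R + 2 * k%:R != 0 :> R.
    by rewrite -natrM -natrD pnatr_eq0 addn_eq0 negb_and -lt0n (leq_ltn_trans _ (ltn_ord
      i)).
  by rewrite /c; field.
rewrite rpredB//; first exact: dhomogM (X1 i) hk.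
by rewrite rpredZ//; exact: dhomogM S2 hik.
Qed.

(** A list of homogeneous pieces is kept instead of their sum because the correction in [hharmXM]
    depends on the degree. Here [r] is the squared radius, as [|x|^2] is the polynomial at hand. *)
Definition sphere_harm r p := exists2 s : seq {mpoly R[n]},
  (forall h, h \in s -> hharm h) &
  forall x, sqnorm x = r -> peval p x = \sum_(h <- s) peval h x.

Lemma sphere_harmD r p q :
  sphere_harm r p -> sphere_harm r q -> sphere_harm r (p + q).
Proof.
move=> [s sh sp] [t th tq]; exists (s ++ t) => [h|x xr].
  by rewrite mem_cat => /orP[/sh|/th].
by rewrite big_cat /= -sp// -tq// /peval mevalD.
Qed.

Lemma sphere_harmZ r c p : sphere_harm r p -> sphere_harm r (c *: p).
Proof.
move=> [s sh sp]; exists [seq c *: h | h <- s] => [_ /mapP[h /sh [k hk h0] ->]|x xr].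
  by exists k; [exact: rpredZ|rewrite lapZ h0 scaler0].
rewrite big_map /peval mevalZ [p.@[_]]sp// mulr_sumr.
by apply: eq_bigr => h _; rewrite /peval mevalZ.
Qed.

Lemma peval_sqX x : peval sqX x = sqnorm x.
Proof.
rewrite /peval /sqX raddf_sum /sqnorm; apply: eq_bigr => i _.
by rewrite /= rmorphXn/= mevalXU.
Qed.

Lemma sphere_harm1 r h : hharm h -> sphere_harm r h.
Proof.
move=> hh; exists [:: h] => [g|x _]; first by rewrite inE => /eqP ->.
by rewrite big_seq1.
Qed.

Lemma sphere_harm_eq r p q : (forall x, sqnorm x = r -> peval p x = peval q x) ->
  sphere_harm r q -> sphere_harm r p.
Proof. by move=> pq [s sh sq]; exists s => // x xr; rewrite pq// sq. Qed.

Lemma sphere_harmX r i p : sphere_harm r p -> sphere_harm r ('X_i * p).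
Proof.
move=> [s sh sp]; apply: (@sphere_harm_eq _ _ (\sum_(h <- s) 'X_i * h)) => [x xr|].
  rewrite /peval mevalM [p.@[_]]sp// -mulr_sumr mevalM; congr (_ * _).
  by rewrite raddf_sum.
elim: s sh {sp} => [_|h s IHs sh].
  by rewrite big_nil; exists [::] => // x _; rewrite big_nil /peval meval0.
rewrite big_cons; apply: sphere_harmD; last first.
  by apply: IHs => g gs; apply: sh; rewrite inE gs orbT.
have [|c [h1 h2]] := hharmXM i (sh h _); first by rewrite inE eqxx.
apply: (@sphere_harm_eq _ _ (('X_i * h - c *: (sqX * h^`M(i))) + (c * r) *: h^`M(i))).
  move=> x xr; have := peval_sqX x; rewrite /peval => sqXE.
  by rewrite mevalD mevalB !mevalZ mevalM mevalM sqXE xr; ring.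
by apply: sphere_harmD; [|apply: sphere_harmZ]; exact: sphere_harm1.
Qed.

Lemma dirichlet_mpoly r p :
  exists2 h, lap h = 0 & forall x, sqnorm x = r -> peval p x = peval h x.
Proof.
have [s sh sp] : sphere_harm r p.
  elim/mpoly_ring_ind: p => [c|p q|c p|i p].
  - apply: sphere_harm1; exists 0%N.
      by apply/dhomogP => m; rewrite msuppC; case: ifP => // _; rewrite inE => /eqP ->;
        rewrite /= mdeg0.
    by rewrite /lap big1// => i _; rewrite mderivC mderiv0.
  - exact: sphere_harmD.
  - exact: sphere_harmZ.
  - exact: sphere_harmX.
exists (\sum_(h <- s) h).
  elim: s sh {sp} => [_|h s IHs sh].
    by rewrite big_nil /lap big1// => i _; rewrite !mderiv0.
  rewrite big_cons lapD IHs ?addr0 => [|g gs]; last by apply: sh; rewrite inE gs orbT.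
  by have [|k _ ->] := sh h; rewrite ?inE ?eqxx.
by move=> x xr; rewrite sp// /peval raddf_sum.
Qed.

(** By the product rule, multiplication by [X_k] replaces [H] by [x_k H] plus the matrix whose row
    [k] is the gradient [b]. That matrix is not symmetric, which is harmless: only the quadratic
    form and the trace of [H] are used. Its trace [b_k] is half of the term [2 d_k p] in [lapXM]. *)
Lemma mpoly_jet2 p x :
  jet2 (peval p) x (fun i => peval p^`M(i) x) (peval (lap p) x / 2).
Proof.
elim/mpoly_ring_ind: p => [c|p q|c p|k p].
- exists 0; exists 0; split=> // [|e y _ _].
    by rewrite raddf0 /lap big1 ?/peval ?meval0 ?mul0r// => i _; rewrite mderivC mderiv0.
  rewrite mul0r /peval !mevalC !big1 => [|i _|i _]; first by rewrite !addr0 subrr normr0.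
    by rewrite big1// => j _; rewrite mxE mul0r.
  by rewrite mderivC meval0 mul0r.
- move=> [H [M [Ht M0 HM]]] [K [N [Kt N0 KN]]]; exists (H + K); exists (M + N); split.
  + by rewrite raddfD/= Ht Kt lapD /peval mevalD mulrDl.
  + exact: addr_ge0.
  move=> e y e01 ye; rewrite mulrDl.
  apply: le_trans (lerD (HM e y e01 ye) (KN e y e01 ye)).
  apply: le_trans (ler_normD _ _); rewrite le_eqVlt; apply/orP; left.
  apply/eqP; congr (`|_|); rewrite /peval !mevalD.
  under eq_bigr do rewrite mderivD mevalD mulrDl.
  rewrite big_split/=.
  under [X in _ - (_ + X)]eq_bigr => i _ do
    (under eq_bigr do rewrite mxE mulrDl; rewrite big_split/=).
  by rewrite big_split/=; ring.
- move=> [H [M [Ht M0 HM]]]; exists (c *: H); exists (`|c| * M); split.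
  + by rewrite linearZ/= Ht lapZ /peval mevalZ mulrA.
  + exact: mulr_ge0.
  move=> e y e01 ye; rewrite -mulrA.
  apply: le_trans (ler_wpM2l (normr_ge0 c) (HM e y e01 ye)).
  rewrite -normrM le_eqVlt; apply/orP; left.
  apply/eqP; congr (`|_|); rewrite /peval !mevalZ.
  under eq_bigr do rewrite mderivZ mevalZ -mulrA.
  rewrite -mulr_sumr.
  under [X in _ - (_ + X)]eq_bigr => i _ do
    (under eq_bigr do rewrite mxE -mulrA; rewrite -mulr_sumr).
  by rewrite -mulr_sumr; ring.
- move=> [H [M [Ht M0 HM]]].
  pose b i := peval p^`M(i) x.
  pose B := \sum_i `|b i| ; pose HH := \sum_i \sum_j `|H i j|.
  exists (x ord0 k *: H + \matrix_(i, j) ((i == k)%:R * b j)).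
  (* With [D] the remainder and [Q] the quadratic part for [p], the new remainder is
     [x_k D + y_k Q + y_k D], one summand for each term. The last is of fourth order and is absorbed
     because [e <= 1]. *)
  exists (`|x ord0 k| * M + HH + M); split.
  + rewrite raddfD/= linearZ/= Ht lapXM /peval mevalD mevalZ mevalM mevalXU.
    rewrite /mxtrace (bigD1 k)//= big1 => [|i /negbTE ik]; last by rewrite mxE ik mul0r.
    by rewrite mxE eqxx mul1r addr0 /b /peval; field.
  + by rewrite !addr_ge0// ?mulr_ge0// /HH sumr_ge0// => i _; rewrite sumr_ge0.
  move=> e y e01 ye; have /andP[e0 e1] := e01.
  have := HM e y e01 ye.
  set L := \sum_i _ * _; set Q := \sum_i \sum_j _ => HMe.
  have Qle : `|Q| <= HH * e ^+ 2.
    rewrite /Q /HH mulr_suml (le_trans (ler_norm_sum _ _ _))// ler_sum// => i _.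
    rewrite mulr_suml (le_trans (ler_norm_sum _ _ _))// ler_sum// => j _.
    by rewrite !normrM ler_wpM2l// expr2 ler_pM.
  have -> : \sum_i peval ('X_k * p)^`M(i) x * y ord0 i = peval p x * y ord0 k + x ord0 k
    * L.
    rewrite /L mulr_sumr (eq_bigr (fun i => (i == k)%:R * (peval p x * y ord0 i) + x ord0
      k * (b i * y ord0 i))); last first.
      move=> i _; rewrite mderivM mderivXU /peval mevalD !mevalM mevalXU.
      by rewrite rmorph_nat /b /peval; ring.
    rewrite big_split/=; congr (_ + _).
    by rewrite (bigD1 k)//= eqxx mul1r big1 ?addr0// => i /negbTE ->; rewrite mul0r.
  have -> : \sum_i \sum_j (x ord0 k *: H + \matrix_(i0, j0) ((i0 == k)%:R * b j0)) i j *
      (y ord0 i * y ord0 j) = x ord0 k * Q + y ord0 k * L.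
    rewrite /Q mulr_sumr.
    rewrite (eq_bigr (fun i => x ord0 k * (\sum_j H i j * (y ord0 i * y ord0 j)) + (i ==
      k)%:R * (y ord0 i * L))); last first.
      move=> i _; rewrite /L !mulr_sumr -big_split/=; apply: eq_bigr => j _.
      by rewrite !mxE /b; ring.
    rewrite big_split/=; congr (_ + _).
    by rewrite (bigD1 k)//= eqxx mul1r big1 ?addr0// => i /negbTE ->; rewrite mul0r.
  have XE z : peval ('X_k * p) z = z ord0 k * peval p z.
    by rewrite /peval mevalM mevalXU.
  rewrite !XE mxE; set D := peval p (x + y) - _ in HMe.
  rewrite (_ : _ - _ = x ord0 k * D + y ord0 k * Q + y ord0 k * D); last first.
    by rewrite /D; ring.
  have yke := ye k.
  apply: le_trans (ler_normD _ _) _; rewrite mulrDl lerD//; last first.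
    rewrite normrM -[leRHS]mul1r ler_pM// (le_trans yke)//.
  apply: le_trans (ler_normD _ _) _; rewrite mulrDl lerD// normrM.
    by rewrite -mulrA ler_wpM2l.
  by rewrite exprS mulrCA ler_pM.
Qed.

Lemma polyfun_sqnorm : polyfun (@sqnorm R n).
Proof. by exists sqX; apply/boolp.funext => x; rewrite peval_sqX. Qed.

Lemma polyfun_jet2 f x : polyfun f -> exists b t, jet2 f x b t.
Proof.
by move=> [p ->]; do 2 eexists; exact: mpoly_jet2.
Qed.

Definition harmfun (f : 'rV[R]_n -> R) := exists2 p, lap p = 0 & f = peval p.

Lemma harmfunD f g : harmfun f -> harmfun g -> harmfun (fun x => f x + g x).
Proof.
move=> [p p0 ->] [q q0 ->]; exists (p + q); first by rewrite lapD p0 q0 addr0.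
by apply/boolp.funext => x; rewrite /peval mevalD.
Qed.

Lemma harmfunZ c f : harmfun f -> harmfun (fun x => c * f x).
Proof.
move=> [p p0 ->]; exists (c *: p); first by rewrite lapZ p0 scaler0.
by apply/boolp.funext => x; rewrite /peval mevalZ.
Qed.

Lemma harmfun_cst c : harmfun (fun=> c).
Proof.
exists c%:MP; first by rewrite /lap big1// => i _; rewrite mderivC mderiv0.
by apply/boolp.funext => x; rewrite /peval mevalC.
Qed.

Lemma harmfun_jet2 f (a : R) x : harmfun f ->
  exists b, jet2 (fun y => f y + a * sqnorm y) x b (a * n%:R).
Proof.
move=> [p p0 ->]; exists (fun i => peval (p + a *: sqX)^`M(i) x).
have := mpoly_jet2 (p + a *: sqX) x.
have -> : peval (p + a *: sqX) = (fun y => peval p y + a * sqnorm y).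
  by apply/boolp.funext => y; rewrite -peval_sqX /peval mevalD mevalZ.
suff -> : peval (lap (p + a *: sqX)) x / 2 = a * n%:R by [].
have d1 i : (1 : {mpoly R[n]})^`M(i) = 0 by rewrite -mpolyC1 mderivC.
have l1 : lap (1 : {mpoly R[n]}) = 0 by rewrite /lap big1// => i _; rewrite d1 mderiv0.
have e1 : eul (1 : {mpoly R[n]}) = 0 by rewrite /eul big1// => i _; rewrite d1 mulr0.
(* Reading [|x|^2] as [sqX * 1], its Laplacian is [2 n], and a jet records half of it. *)
rewrite lapD lapZ p0 add0r -[sqX]mulr1 lap_sqXM l1 e1 mulr0 scaler0 !addr0.
by rewrite /peval !mevalZ meval1; field.
Qed.

Lemma dirichlet_sphere (r : R) (f : 'rV[R]_n -> R) : polyfun f ->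
  exists2 h : 'rV[R]_n -> R, harmfun h & forall x, sqnorm x = r -> h x = f x.
Proof.
move=> [p ->]; have [h h0 hp] := dirichlet_mpoly r p.
by exists (peval h) => [|x xr]; [exists h|rewrite hp].
Qed.

End Evaluation.

End PolynomialFunctions.

From mathcomp Require Import all_classical all_reals all_analysis.
From mathcomp Require Import measurable_realfun.

Import Order.TTheory GRing.Theory Num.Theory.
Import numFieldNormedType.Exports.

Local Open Scope classical_set_scope.
Local Open Scope ring_scope.

Import PolynomialFunctions.

(** * Polynomial approximation *)

Definition norm1 (R : numDomainType) n (x : 'rV[R]_n) : R := \sum_i `|x ord0 i|.

Section Weierstrass.
Context {R : realType} {n : nat}.
Implicit Types (x y t : 'rV[R]_n) (s : seq 'I_n).

(* The mean of [f] at the end point of the walk that starts at [y] and, for each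
   [i] in [s], independently moves by [h] in direction [i] with probability
   [t_i]; for constant [s] this is a Bernstein polynomial in [t]. *)
Fixpoint walk_mean (h : R) (f : 'rV[R]_n -> R) s t y : R :=
  if s is i :: s' then
    (1 - t ord0 i) * walk_mean h f s' t y +
    t ord0 i * walk_mean h f s' t (y + h *: delta_mx ord0 i)
  else f y.

Lemma polyfun_walk_mean h f s (T : 'rV[R]_n -> 'rV[R]_n) y :
  (forall i, polyfun (fun x => T x ord0 i)) ->
  polyfun (fun x => walk_mean h f s (T x) y).
Proof.
move=> pT; elim: s y => [|i s IHs] y /=; first exact: polyfun_cst.
apply: polyfunD; apply: polyfunM => //.
rewrite (_ : (fun x => _) = (fun x => 1 + (-1) * T x ord0 i)); last first.
  by apply/funext => x; rewrite mulN1r.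
apply: polyfunD; first exact: polyfun_cst.
by apply: polyfunM => //; exact: polyfun_cst.
Qed.

Lemma le_walk_mean h f g s t y : (forall i, 0 <= t ord0 i <= 1) ->
  (forall z, f z <= g z) -> walk_mean h f s t y <= walk_mean h g s t y.
Proof.
move=> t01 fg; elim: s y => [|i s IHs] y //=.
have /andP[t0 t1] := t01 i.
by rewrite lerD// ler_wpM2l// subr_ge0.
Qed.

(** Variance plus squared bias: coordinate [i] of the end point is [y_i + h B] with [B] binomial,
    for [count_mem i s] trials of probability [t_i]. *)
Lemma walk_mean_sqr h c K a s t y :
  walk_mean h (fun z => c + K * \sum_i (z ord0 i - a i) ^+ 2) s t y =
  c + K * \sum_i ((count_mem i s)%:R * (h ^+ 2 * (t ord0 i * (1 - t ord0 i))) +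
    (y ord0 i + (count_mem i s)%:R * (h * t ord0 i) - a i) ^+ 2).
Proof.
elim: s y => [|j s IHs] y /=.
  congr (_ + _ * _); apply: eq_bigr => i _; ring.
rewrite !IHs !mulrDr addrACA -mulrDl subrK mul1r; congr (_ + _).
rewrite mulrCA [X in _ + X]mulrCA -mulrDr; congr (_ * _).
rewrite !mulr_sumr -big_split/=; apply: eq_bigr => i _.
rewrite !mxE eqxx /= [i == j]eq_sym natrD.
case: eqP => [->|_] /=; ring.
Qed.

(** Since [|a| <= dl + a^2 / dl], the function [f] lies between the paraboloids [f x - q] and
    [f x + q] centred at [x]. Means are monotone, and the mean of a paraboloid is known exactly, so
    only the variance of a walk with mean end point [x] remains. *)
Lemma lipschitz_polyfun_approx f (L r e : R) : 0 <= L ->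
  (forall x y, f x - f y <= L * norm1 (x - y)) -> 0 < r -> 0 < e ->
  exists2 g : 'rV[R]_n -> R, polyfun g &
    forall x, (forall i, `|x ord0 i| <= r) -> `|g x - f x| <= e.
Proof.
move=> L0 fL r0 e0.
pose Ln : R := L * n%:R; have Ln0 : 0 <= Ln by rewrite mulr_ge0.
(* This choice makes [Ln * dl] at most [e / 2]; then [m] makes the variance term [4 Ln r^2 / (dl m)]
   at most [e / 2]. *)
pose dl : R := e / (2 * (Ln + 1)).
have dl0 : 0 < dl by rewrite divr_gt0// mulr_gt0// ltr_wpDl.
pose m : nat := (Num.truncn (8 * Ln * r ^+ 2 / (dl * e))).+1.
have mP : 8 * Ln * r ^+ 2 / (dl * e) < m%:R by exact: truncnS_gt.
have m0 : 0 < m%:R :> R by [].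
pose h : R := 2 * r / m%:R.
pose s := flatten (nseq m (enum 'I_n)).
have sE i : count_mem i s = m.
  rewrite /s; elim: (m) => //= k IHk; rewrite count_cat IHk.
  by rewrite count_uniq_mem ?enum_uniq// mem_enum.
pose y0 : 'rV[R]_n := \row_i (- r).
(* From the corner [y0], with [m] steps of length [h = 2 r / m] in each direction, these
   probabilities put the mean end point at [x]. *)
pose T x : 'rV[R]_n := \row_i ((x ord0 i + r) / (2 * r)).
exists (fun x => walk_mean h f s (T x) y0).
  apply: polyfun_walk_mean => i.
  rewrite (_ : (fun x => _) = (fun x => (x ord0 i + r) * (2 * r)^-1)); last first.
    by apply/funext => x; rewrite mxE.
  apply: polyfunM; last exact: polyfun_cst.
  by apply: polyfunD; [exact: polyfun_coord|exact: polyfun_cst].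
move=> x xr.
have T01 i : 0 <= T x ord0 i <= 1.
  have := xr i; rewrite ler_norml mxE => /andP[xr1 xr2].
  rewrite divr_ge0 ?mulr_ge0 ?(ltW r0)//=; last by rewrite -lerBlDr sub0r.
  by rewrite ler_pdivrMr ?mulr_gt0// mul1r mulr_natl mulr2n lerD2r.
pose q (z : 'rV[R]_n) : R := L * n%:R * dl + L / dl * \sum_i (z ord0 i - x ord0 i) ^+ 2.
have norm1q z : L * norm1 (z - x) <= q z.
  rewrite /q -!mulrA -mulrDr ler_wpM2l// /norm1.
  have -> : n%:R * dl = \sum_(i < n) dl by rewrite sumr_const card_ord mulr_natl.
  rewrite mulr_sumr -big_split/=; apply: ler_sum => i _; rewrite !mxE.
  rewrite -real_normK ?num_real//; set a := `|_|.
  have := sqr_ge0 (a - dl); have a0 : 0 <= a by exact: normr_ge0.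
  by move=> sq; rewrite [X in _ + X]mulrC -lerBlDl ler_pdivlMr//; nra.
have meanE (K c : R) : walk_mean h (fun z => c + K * \sum_i (z ord0 i - x ord0 i) ^+ 2) s
  (T x) y0 =
   c + K * \sum_i (m%:R * (h ^+ 2 * (T x ord0 i * (1 - T x ord0 i)))).
  rewrite walk_mean_sqr; congr (_ + _ * _); apply: eq_bigr => i _.
  rewrite sE -[RHS]addr0; congr (_ + _).
  rewrite !mxE (_ : _ - _ = 0) ?expr0n// /h.
  by field; rewrite !gt_eqF//=.
set V := \sum_i _ in meanE.
have Vle : V <= n%:R * (4 * r ^+ 2 / m%:R).
  have -> : n%:R * (4 * r ^+ 2 / m%:R) = \sum_(i < n) (4 * r ^+ 2 / m%:R).
    by rewrite sumr_const card_ord mulr_natl.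
  apply: ler_sum => i _; have /andP[t0 t1] := T01 i.
  rewrite -[leRHS]mulr1 mulrA (_ : m%:R * h ^+ 2 = 4 * r ^+ 2 / m%:R); last first.
    by rewrite /h; field; rewrite gt_eqF.
  by apply: ler_wpM2l; [rewrite divr_ge0// mulr_ge0// sqr_ge0|nra].
have small : Ln * dl + L / dl * V <= e.
  have -> : e = e / 2 + e / 2 by rewrite -splitr.
  rewrite lerD//.
    rewrite /dl mulrA ler_pdivrMr ?mulr_gt0 ?ltr_wpDl//.
    by rewrite mulrA divfK ?pnatr_eq0// mulrDr mulr1 mulrC lerDl ltW.
  apply: le_trans (ler_wpM2l _ Vle) _; first by rewrite divr_ge0// ltW.
  rewrite (_ : L / dl * _ = 4 * Ln * r ^+ 2 / dl / m%:R); last first.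
    by rewrite /Ln; move: dl0 m0; move: (dl) (m%:R : R) => u v u0 v0; field;
      rewrite !gt_eqF.
  rewrite ler_pdivrMr//.
  move: mP; rewrite (ltr_pdivrMr _ _ (mulr_gt0 dl0 e0)) => mP.
  by rewrite ler_pdivrMr//; nra.
rewrite ler_norml; apply/andP; split.
  rewrite lerBrDr addrC.
  have le1 z : f x - q z <= f z.
    rewrite lerBlDr -lerBlDl (le_trans (fL _ _))// (le_trans _ (norm1q z))//.
    rewrite ler_wpM2l// /norm1 le_eqVlt; apply/orP; left; apply/eqP.
    by apply: eq_bigr => i _; rewrite !mxE distrC.
  apply: le_trans (le_walk_mean h s y0 T01 le1).
  rewrite (_ : (fun z => _) = (fun z : 'rV[R]_n => (f x - Ln * dl) + (- (L / dl)) *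
    \sum_i (z ord0 i - x ord0 i) ^+ 2)); last first.
    by apply/funext => z; rewrite /q /Ln; ring.
  by rewrite meanE mulNr -addrA -opprD lerD2l lerN2.
rewrite lerBlDr addrC.
have le2 z : f z <= f x + q z.
  by rewrite -lerBlDl (le_trans (fL _ _))// (le_trans _ (norm1q z)).
apply: (le_trans (le_walk_mean h s y0 T01 le2)).
rewrite (_ : (fun z => _) = (fun z : 'rV[R]_n => (f x + Ln * dl) + (L / dl) * \sum_i (z
  ord0 i - x ord0 i) ^+ 2)); last first.
  by apply/funext => z; rewrite /q /Ln; ring.
by rewrite meanE -addrA lerD2l.
Qed.

End Weierstrass.

(** * Inf-convolutions as Lipschitz approximations from below *)

Section InfConvolution.
Context {R : realType} {n : nat}.
Implicit Types (x y : 'rV[R]_n) (w : 'rV[R]_n -> R).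

Lemma norm1_ge0 x : 0 <= norm1 x.
Proof. exact: sumr_ge0. Qed.

Lemma norm1_triangle x y : norm1 (x + y) <= norm1 x + norm1 y.
Proof.
rewrite /norm1 -big_split/=; apply: ler_sum => i _.
by rewrite mxE ler_normD.
Qed.

Lemma le_coord_norm1 x i : `|x ord0 i| <= norm1 x.
Proof. by rewrite /norm1 (bigD1 i)//= lerDl sumr_ge0. Qed.

Definition infconv k w x : R := inf [set w y + k * norm1 (x - y) | y in setT].

Variables (w : 'rV[R]_n -> R) (c : R).
Hypothesis cw : forall x, c <= w x.

Let lb k x : 0 <= k -> lbound [set w y + k * norm1 (x - y) | y in setT] c.
Proof.
by move=> k0 _ [y _ <-]; rewrite -[c]addr0 lerD// mulr_ge0// norm1_ge0.
Qed.

Lemma infconv_le k x y : 0 <= k -> infconv k w x <= w y + k * norm1 (x - y).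
Proof. by move=> k0; apply: ge_inf; [exists c; exact: lb|exists y]. Qed.

Lemma infconv_ge k x a : (forall y, a <= w y + k * norm1 (x - y)) ->
  a <= infconv k w x.
Proof.
move=> h; apply: lb_le_inf; last by move=> _ [y _ <-].
by exists (w x + k * norm1 (x - x)); exists x.
Qed.

Lemma infconv_lipschitz k x y : 0 <= k ->
  infconv k w x - infconv k w y <= k * norm1 (x - y).
Proof.
move=> k0; rewrite lerBlDr -lerBlDl; apply: infconv_ge => z.
rewrite lerBlDl (le_trans (infconv_le x z k0))//.
rewrite addrCA lerD2l -mulrDr ler_wpM2l//.
by rewrite -[x - z](subrKA y) norm1_triangle.
Qed.

(** Points [y] close to [x'] have [w y > a]; for the others the penalty [k * (e / 2)] exceeds
    [|a - c|] once [k >= k0]. The bound is joint in [x'] and [k], as the covering argument for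
    Dini's theorem requires. *)
Lemma infconv_near x a : (\forall x' \near x, a < w x') ->
  \forall x' \near x & k \near \oo, a <= infconv k%:R w x'.
Proof.
move=> /nbhs_ballP[e /= e0 ew].
have e20 : 0 < e / 2 by rewrite divr_gt0.
pose k0 := (Num.truncn (`|a - c| / (e / 2))).+1.
have k0P : `|a - c| / (e / 2) < k0%:R by exact: truncnS_gt.
exists (ball x (e / 2), [set k | k0 <= k]%N) => /=.
  by split; [exact: nbhsx_ballx|exists k0].
move=> [x' k] /= [xx' kk]; apply: infconv_ge => y.
have [lt|ge] := ltP (norm1 (x' - y)) (e / 2).
  apply: (@le_trans _ _ (w y)); last by rewrite lerDl mulr_ge0 ?norm1_ge0.
  apply/ltW/ew; rewrite [e]splitr; apply: (ball_triangle xx').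
  rewrite /ball/=; split => // i j; rewrite ord1 /ball/=.
  by apply: le_lt_trans lt; have := le_coord_norm1 (x' - y) j; rewrite !mxE.
rewrite -lerBlDl (@le_trans _ _ `|a - c|)//.
  by rewrite (le_trans _ (ler_norm _))// lerB.
move: k0P; rewrite ltr_pdivrMr// => /ltW /le_trans; apply.
by rewrite ler_pM// ?ler_nat// ltW.
Qed.

End InfConvolution.

Section ApproximationFromBelow.
Context {R : realType} {n : nat}.

Lemma lsc_polyfun_approx_real (J : finType) (P : pred J)
    (w : J -> 'rV[R]_n -> R) (c m : R) (S : set 'rV[R]_n) (r e : R) :
  (forall j x, c <= w j x) ->
  (forall j x a, a < w j x -> \forall x' \near x, a < w j x') ->
  compact S -> 0 < r -> (forall x, S x -> forall i, `|x ord0 i| <= r) ->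
  (forall x, S x -> m <= \sum_(j | P j) w j x) -> 0 < e ->
  exists g : J -> 'rV[R]_n -> R, [/\ forall j, polyfun (g j),
    forall j x, S x -> g j x <= w j x &
    forall x, S x -> m - e <= \sum_(j | P j) g j x].
Proof.
move=> cw wlsc cS r0 Sr mw e0.
(* Each term loses [d] three times: to the inf-convolution, to the polynomial error, and to the
   shift that puts the polynomial below [w j]. The [+ 1] covers an empty [J]. *)
pose d := e / (3 * (#|J|%:R + 1)).
have J0 : 0 < #|J|%:R + 1 :> R by rewrite ltr_wpDl.
have d0 : 0 < d by rewrite divr_gt0// mulr_gt0.
have sumd : \sum_(j | P j) 3 * d <= e.
  rewrite sumr_const -[_ *+ #|_|]mulr_natl (@le_trans _ _ (#|J|%:R * (3 * d)))//.
    by rewrite ler_wpM2r// ?ler_nat ?max_card// mulr_ge0// ltW.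
  rewrite /d mulrA mulrA ler_pdivrMr ?mulr_gt0//; nra.
have [k kP] : exists k : nat, forall x, S x ->
    m - \sum_(j | P j) d <= \sum_(j | P j) infconv k%:R (w j) x.
  (* Dini's argument: every point of [S] has a neighbourhood on which all large [k] work, and
     compactness makes the rank uniform. *)
  have : \forall k \near \oo, S `<=` [set x |
      m - \sum_(j | P j) d <= \sum_(j | P j) infconv k%:R (w j) x].
    have /compact_near_coveringP/(_ nat \oo (fun k x =>
      m - \sum_(j | P j) d <= \sum_(j | P j) infconv k%:R (w j) x)) := cS.
    apply => x Sx.
    have FF : Filter (filter_prod (nbhs x) \oo) by exact: filter_prod_filter.
    have : \forall x' \near x & k \near \oo, forall j,
        w j x - d <= infconv k%:R (w j) x'.
      apply: (@filter_forall _ J (fun j (p : 'rV[R]_n * nat) =>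
        w j x - d <= infconv p.2%:R (w j) p.1) _ FF) => j.
      apply: (@infconv_near _ _ _ c) => //.
      by apply: wlsc; rewrite ltrBlDr ltrDl.
    apply: filterS => -[x' k] /= H.
    apply: (@le_trans _ _ (\sum_(j | P j) (w j x - d))).
      by rewrite sumrB lerB// mw.
    by apply: ler_sum => j _; exact: H.
  by move=> [k _ kP]; exists k; apply: (kP k) => /=.
have gP j : exists g, polyfun g /\ forall x : 'rV[R]_n, (forall i, `|x ord0 i| <= r) ->
    `|g x - infconv k%:R (w j) x| <= d.
  have kl (x y : 'rV[R]_n) : infconv k%:R (w j) x - infconv k%:R (w j) y <= k%:R * norm1
    (x - y).
    exact: (@infconv_lipschitz _ _ _ c).
  have [g pg gd] := lipschitz_polyfun_approx (ler0n R k) kl r0 d0.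
  by exists g.
have [g {}gP] := choice gP.
exists (fun j x => g j x - d); split => [j|j x Sx|x Sx].
- by apply: polyfunD; [exact: (gP j).1|exact: polyfun_cst].
- have := (gP j).2 x (Sr _ Sx); rewrite ler_norml => /andP[_]; rewrite lerBlDr.
  have := @infconv_le R n (w j) c (cw j) k%:R x x (ler0n _ _).
  have -> : norm1 (x - x) = 0.
    by rewrite subrr /norm1 big1// => i _; rewrite mxE normr0.
  by rewrite mulr0 addr0; lra.
- apply: (@le_trans _ _ (\sum_(j | P j) (infconv k%:R (w j) x - 2 * d))).
    rewrite sumrB; have := kP _ Sx.
    have : \sum_(j | P j) d + \sum_(j | P j) 2 * d <= e.
      by rewrite -big_split/= (le_trans _ sumd)// ler_sum// => j _; lra.
    by lra.
  apply: ler_sum => j _.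
  have := (gP j).2 x (Sr _ Sx); rewrite ler_norml => /andP[+ _].
  by lra.
Qed.

Lemma lsc_polyfun_approx (J : finType) (P : pred J)
    (u : J -> 'rV[R]_n -> \bar R) (c m : R) (S : set 'rV[R]_n) (r e : R) :
  (forall j x, (c%:E <= u j x)%E) ->
  (forall j, lower_semicontinuous (u j)) ->
  compact S -> 0 < r -> (forall x, S x -> forall i, `|x ord0 i| <= r) ->
  (forall x, S x -> (m%:E <= \sum_(j | P j) u j x)%E) -> 0 < e ->
  exists g : J -> 'rV[R]_n -> R, [/\ forall j, polyfun (g j),
    forall j x, S x -> ((g j x)%:E <= u j x)%E &
    forall x, S x -> m - e <= \sum_(j | P j) g j x].
Proof.
move=> cu ulsc cS r0 Sr mu e0.
(* Truncation at [T] keeps the lower bound [m] on the sum: where some term exceeds [T], the value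
   [T] alone compensates all other terms, each at least [- |c|]. *)
pose T := `|m| + (#|J|%:R + 1) * `|c|.
pose w j x := fine (mine (u j x) T%:E).
have cT : c <= T.
  rewrite /T mulrDl mul1r; have := ler_norm c; have := normr_ge0 m.
  by have : 0 <= #|J|%:R * `|c| by []; lra.
have wE j x : (w j x)%:E = mine (u j x) T%:E.
  rewrite /w; have := cu j x; case: (u j x) => [b _|_|//].
    by rewrite -EFin_min.
  by rewrite min_r ?leey.
have cw j x : c <= w j x.
  by rewrite -lee_fin wE le_min cu lee_fin.
have wu j x : ((w j x)%:E <= u j x)%E by rewrite wE ge_min lexx.
have wlsc j x a : a < w j x -> \forall x' \near x, a < w j x'.
  rewrite -lte_fin wE lt_min => /andP[au aT].
  have [V xV Va] := ulsc j _ _ au.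
  by apply: filterS xV => y /Va ay; rewrite -lte_fin wE lt_min ay.
have mw x : S x -> m <= \sum_(j | P j) w j x.
  move=> Sx.
  have [/existsP[j /andP[Pj uT]]|] := boolP [exists j, P j && (T%:E < u j x)%E].
    have wT : w j x = T by apply: EFin_inj; rewrite wE min_r// ltW.
    rewrite (bigD1 j)//= wT.
    apply: (@le_trans _ _ (T + \sum_(i | P i && (i != j)) - `|c|)); last first.
      by rewrite lerD2l ler_sum// => i _; rewrite (le_trans _ (cw i x))// lerNl (le_trans
        (ler_norm _))// normrN.
    rewrite sumr_const mulNrn /T.
    have : `|c| *+ #|(fun i : J => P i && (i != j))| <= #|J|%:R * `|c|.
      by rewrite -[leLHS]mulr_natl ler_wpM2r// ler_nat max_card.
    by have := ler_norm m; have := normr_ge0 c; lra.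
  rewrite negb_exists => /forallP uT.
  rewrite -lee_fin -sumEFin (le_trans (mu _ Sx))//.
  apply: lee_sum => j Pj; rewrite wE le_min lexx/= leNgt.
  by have := uT j; rewrite Pj.
have [g [pg gw mg]] := lsc_polyfun_approx_real cw wlsc cS r0 Sr mw e0.
by exists g; split => // j x Sx; rewrite (le_trans _ (wu j x))// lee_fin gw.
Qed.

End ApproximationFromBelow.

(** * Minima of lower semicontinuous functions and touching from below *)

Section Touching.
Context {R : realType} {n : nat}.

Lemma lsc_compact_min (T : ptopologicalType) (v : T -> \bar R) (K : set T) :
  lower_semicontinuous v -> (forall x, (-oo < v x)%E) -> compact K -> K !=set0 ->
  exists2 x, K x & forall y, K y -> (v x <= v y)%E.
Proof.
move=> vlsc vNy cK [z Kz]; apply: contrapT => nmin.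
have lower x : K x -> exists2 y, K y & (v y < v x)%E.
  move=> Kx; apply: contrapT => nx; apply: nmin; exists x => // y Ky.
  by rewrite leNgt; apply/negP => yx; apply: nx; exists y.
(* The filter generated by the sublevel sets of [v] in [K]. Without a minimum, compactness would
   give a [y] in [K] with [v y < v x] for every [x] in [K], including [x = y]. *)
pose F : set_system T :=
  [set A | exists2 y, K y & forall y', K y' -> (v y' <= v y)%E -> A y'].
have FF : Filter F.
  split; first by exists z.
    move=> A B [a Ka aA] [b Kb bB].
    have [ab|/ltW ba] := leP (v a) (v b).
      by exists a => // y Ky ya; split; [exact: aA|apply: bB => //; exact: le_trans ab].
    by exists b => // y Ky yb; split; [apply: aA => //; exact: le_trans ba|exact: bB].
  by move=> A B AB [a Ka aA]; exists a => // y Ky /(aA _ Ky)/AB.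
have /compact_near_coveringP/(_ T F (fun y x => (v y < v x)%E) FF) := cK.
case=> [x Kx|y Ky /(_ y Ky (lexx _))].
  have [y Ky] := lower x Kx.
  have := vNy y; case vy : (v y) => [a| |]// _ yx.
    have [V xV Va] := vlsc _ _ yx.
    exists (V, [set y' | K y' /\ (v y' <= v y)%E]) => /=.
      by split => //; exists y.
    by move=> [x' y'] /= [/Va ax [_]]; rewrite vy => /le_lt_trans; apply.
  by move: yx; rewrite ltNge leey.
by move=> /(_ y Ky); rewrite ltxx.
Qed.

Lemma lsc_sub_continuous (T : topologicalType) (u : T -> \bar R) (g : T -> R) :
  lower_semicontinuous u -> continuous g ->
  lower_semicontinuous (fun x => (u x - (g x)%:E)%E).
Proof.
move=> ulsc cg x a; rewrite lteBrDr// -EFinD => aux.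
have [b ab bu] : exists2 b, a + g x < b & (b%:E < u x)%E.
  move: aux; case: (u x) => [s| |]; rewrite ?lte_fin => h.
  - by exists ((a + g x + s) / 2); rewrite ?lte_fin; lra.
  - by exists (a + g x + 1); rewrite ?ltry// ltrDl.
  - by [].
have [V xV Vb] := ulsc _ _ bu.
exists (V `&` [set y | g y < b - a]).
  by apply: filterI => //; apply: (cvgr_lt (g x) (cg x)); rewrite ltrBrDl.
move=> y [/Vb by_ gy]; rewrite lteBrDr// -EFinD; apply: lt_trans by_.
by rewrite lte_fin -ltrBrDl.
Qed.

Lemma jet2_continuous (f : 'rV[R]_n -> R) :
  (forall x, exists b t, jet2 f x b t) -> continuous f.
Proof.
move=> jf x; have [b [t [H [M [_ M0 HM]]]]] := jf x.
pose C := \sum_i `|b i| + \sum_i \sum_j `|H i j| + M + 1.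
have B0 : 0 <= \sum_i `|b i| by exact: sumr_ge0.
have H0 : 0 <= \sum_i \sum_j `|H i j| by rewrite sumr_ge0// => i _; exact: sumr_ge0.
have C0 : 0 < C by rewrite ltr_wpDl// !addr_ge0.
move=> A /nbhs_ballP[e' /= e'0 eA].
pose e := e' / 2; have e0 : 0 < e by rewrite divr_gt0.
pose d := Num.min 1 (e / C).
have d0 : 0 < d by rewrite lt_min ltr01 divr_gt0.
have d1 : d <= 1 by rewrite ge_min lexx.
have de : d * C <= e by rewrite -ler_pdivlMr// ge_min lexx orbT.
apply/nbhs_ballP; exists d => //= z xz; apply: eA; rewrite /ball/=.
apply: (@le_lt_trans _ _ e); last by rewrite /e gtr_pMr// invf_lt1// ltr1n.
have yd i : `|(z - x) ord0 i| <= d.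
  by case: xz => _ /(_ ord0 i); rewrite !mxE distrC => /ltW.
have d01 : 0 <= d <= 1 by rewrite ltW.
have := HM d (z - x) d01 yd; rewrite [x + _]addrC subrK.
set L := \sum_i _ * _; set Q := \sum_i \sum_j _ => HMe.
have Lle : `|L| <= (\sum_i `|b i|) * d.
  rewrite mulr_suml (le_trans (ler_norm_sum _ _ _))// ler_sum// => i _.
  by rewrite normrM ler_wpM2l.
have Qle : `|Q| <= (\sum_i \sum_j `|H i j|) * d.
  rewrite mulr_suml (le_trans (ler_norm_sum _ _ _))// ler_sum// => i _.
  rewrite mulr_suml (le_trans (ler_norm_sum _ _ _))// ler_sum// => j _.
  by rewrite !normrM ler_wpM2l// -[leRHS]mulr1 ler_pM// (le_trans (yd _)).
have Me : M * d ^+ 3 <= M * d.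
  by rewrite ler_wpM2l// -[leRHS]expr1 ler_wiXn2l// ltW.
rewrite distrC (le_trans _ de)//.
rewrite (_ : f z - f x = (f z - (f x + L + Q)) + (L + Q)); last by ring.
rewrite (le_trans (ler_normD _ _))// /C !mulrDr mulr1.
have := ler_normD L Q; have := ltW d0; lra.
Qed.

Lemma sqnorm_continuous : continuous (@sqnorm R n).
Proof. by apply: jet2_continuous => x; exact/polyfun_jet2/polyfun_sqnorm. Qed.

Lemma sqnorm0 : sqnorm (0 : 'rV[R]_n) = 0.
Proof. by rewrite /sqnorm big1// => i _; rewrite mxE expr0n. Qed.

Lemma coord_le_sqnorm (x : 'rV[R]_n) (r : R) i :
  0 <= r -> sqnorm x <= r ^+ 2 -> `|x ord0 i| <= r.
Proof.
move=> r0 xr; rewrite -(@ler_pXn2r _ 2)// ?nnegrE//.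
rewrite real_normK ?num_real// (le_trans _ xr)//.
by rewrite /sqnorm (bigD1 i)//= lerDl sumr_ge0// => j _; exact: sqr_ge0.
Qed.

Lemma compact_sqball (r : R) : compact [set x : 'rV[R]_n | sqnorm x <= r].
Proof.
apply: bounded_closed_compact; last first.
  apply: (@closed_comp _ _ (@sqnorm R n) [set t | t <= r]); last exact: closed_le.
  by move=> x _; exact: sqnorm_continuous.
have [r0|r0] := leP 0 r; last first.
  exists 0; split => // M _ x /= xr; exfalso.
  have : sqnorm x < 0 by exact: le_lt_trans r0.
  by rewrite ltNge sumr_ge0// => i _; exact: sqr_ge0.
exists (Num.sqrt r); split; first exact: num_real.
move=> M rM x /= xr; apply/ltW.
rewrite (_ : `|x| = mx_norm x)// mx_normrE; apply/bigmax_ltP; split.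
  exact: le_lt_trans rM.
move=> [i j] _ /=; rewrite ord1; apply: le_lt_trans rM.
by apply: coord_le_sqnorm; rewrite ?sqrtr_ge0// sqr_sqrtr.
Qed.

Lemma compact_sqsphere (r : R) : compact [set x : 'rV[R]_n | sqnorm x = r].
Proof.
apply: (subclosed_compact _ (@compact_sqball r)) => [|x /= ->//].
apply: (@closed_comp _ _ (@sqnorm R n) [set t | t = r]); last exact: closed_eq.
by move=> x _; exact: sqnorm_continuous.
Qed.

(** The minimum of [u - g] over the closed ball is negative because of the value at 0, while
    [u - g >= 0] on the sphere; it is therefore attained inside, at a point where [u] is finite. *)
Lemma touching_point (u : 'rV[R]_n -> \bar R) (g : 'rV[R]_n -> R) (r : R) :
  lower_semicontinuous u -> (forall x, -oo < u x)%E -> continuous g -> 0 < r ->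
  (forall x, sqnorm x = r -> ((g x)%:E <= u x)%E) -> (u 0%R < (g 0%R)%:E)%E ->
  exists x, exists2 s, sqnorm x < r /\ u x = s%:E &
    forall y, sqnorm y <= r -> ((s + (g y - g x))%:E <= u y)%E.
Proof.
move=> ulsc uNy cg r0 gu u0.
pose K := [set x : 'rV[R]_n | sqnorm x <= r].
have cK : compact K := @compact_sqball r.
have [x Kx xmin] : exists2 x, K x & forall y, K y -> (u x - (g x)%:E <= u y - (g y)%:E)%E.
  apply: lsc_compact_min cK _; first exact: lsc_sub_continuous.
    by move=> x; have := uNy x; case: (u x) => [s _| |]//; rewrite -EFinB ltNyr.
  by exists 0; rewrite /K/= sqnorm0 ltW.
have ux : (u x < (g x)%:E)%E.
  have K0 : K 0 by rewrite /K/= sqnorm0 ltW.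
  by rewrite -suber_lt0//; apply: le_lt_trans (xmin _ K0) _; rewrite suber_lt0.
move: ux (uNy x) xmin; case us : (u x) => [s| |]// sg _ xmin.
exists x, s.
  split => //; move: Kx; rewrite /K/= le_eqVlt => /orP[/eqP xr|//].
  by have := gu _ xr; rewrite us leNgt sg.
move=> y /xmin; rewrite leeBrDr// -EFinB -EFinD.
by rewrite (_ : s - g x + g y = s + (g y - g x)); last by ring.
Qed.

End Touching.

(** * Lebesgue measure under isometries, moments of balls *)

Section LebesgueInvariance.
Context {R : realType} {n : nat}.
Local Notation mu := (lebesgue_rV R n).

Definition rV_box (A : 'I_n -> set R) : set 'rV[R]_n :=
  [set x | forall i, A i (x ord0 i)].

Definition rV_boxes : set (set 'rV[R]_n) :=
  [set B | exists2 A : 'I_n -> set R, (forall i, measurable (A i)) & B = rV_box A].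

(** For the inclusion of open sets, the identity is measurable from the box sigma-algebra because
    its coordinates are. *)
Lemma measurable_rV_boxes : measurable = <<s rV_boxes >>.
Proof.
apply/seteqP; split; last first.
  apply: smallest_sub; first exact: sigma_algebra_measurable.
  by move=> _ [A mA ->]; exact: measurable_box.
apply: smallest_sub; first exact: smallest_sigma_algebra.
move=> U oU.
have mid : measurable_fun setT (id : g_sigma_algebraType rV_boxes -> 'rV[R]_n).
  apply: measurable_fun_rV => i _ A mA; rewrite setTI.
  apply: sub_sigma_algebra.
  exists (fun j => if j == i then A else setT); first by move=> j; case: ifP.
  apply/seteqP; split => x /= xA; last by have := xA i; rewrite eqxx.
  by move=> j; case: eqP => [->|].
by have := mid measurableT _ (open_measurable_rV oU); rewrite setTI.
Qed.

Lemma lebesgue_rV_unique (m : {measure set 'rV[R]_n -> \bar R}) :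
  (forall A : 'I_n -> set R, (forall i, measurable (A i)) ->
     m (rV_box A) = (\prod_(i < n) @lebesgue_measure R (A i))%E) ->
  forall B, measurable B -> m B = mu B.
Proof.
move=> mE B mB.
pose g k : set 'rV[R]_n := rV_box (fun=> `]- k%:R, k%:R[%classic).
apply: (measure_unique rV_boxes g) => //.
- exact: measurable_rV_boxes.
- move=> _ _ [A mA ->] [A' mA' ->]; exists (fun i => A i `&` A' i).
    by move=> i; exact: measurableI.
  apply/seteqP; split => x /=; first by move=> [xA xA'] i; split.
  by move=> xAA; split => i; have [] := xAA i.
- by move=> k; exists (fun=> `]- k%:R, k%:R[%classic).
- apply/seteqP; split => // x _.
  exists (Num.truncn (norm1 x)).+1 => // i /=; rewrite in_itv/= -ltr_norml.
  by rewrite (le_lt_trans (le_coord_norm1 x i))// truncnS_gt.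
- by move=> _ [A mA ->]; rewrite mE// [RHS](lebesgue_rV_box mA).
- move=> k; rewrite mE// ltey_eq prode_fin_num// => i _.
  by rewrite lebesgue_measure_itv/=; case: ifP => // _; rewrite -EFinD.
Qed.

Lemma measurable_continuous_rV (f : 'rV[R]_n -> R) :
  continuous f -> measurable_fun setT f.
Proof.
move=> cf; apply: (measurability _ (RGenOpens.measurableE R)) => _ [_ [a [b ->]] <-].
rewrite setTI; apply: open_measurable_rV.
by apply: open_comp; [move=> x _; exact: cf|exact: interval_open].
Qed.

(** A single family containing translations, reflections of one coordinate and swaps of two.
    Preimages of boxes are boxes, so invariance of the measure reduces to dimension one. *)
Definition row_permmap (s : 'S_n) (f : 'I_n -> R -> R) (x : 'rV[R]_n) : 'rV[R]_n :=
  \row_i f i (x ord0 (s i)).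

Lemma measurable_row_permmap s f : (forall i, measurable_fun setT (f i)) ->
  measurable_fun setT (row_permmap s f).
Proof.
move=> mf; apply: measurable_fun_rV => i.
rewrite (_ : (fun t => _) = f i \o (fun x : 'rV[R]_n => x ord0 (s i))); last first.
  by apply/funext => x; rewrite mxE.
by apply: measurableT_comp => //; exact: measurable_coord.
Qed.

Lemma lebesgue_rV_permmap s f B : (forall i, measurable_fun setT (f i)) ->
  (forall i A, measurable A -> @lebesgue_measure R (f i @^-1` A) = @lebesgue_measure R A) ->
  measurable B -> mu (row_permmap s f @^-1` B) = mu B.
Proof.
move=> mf fE mB; have mT := measurable_row_permmap s mf.
pose m := measure_function_pushforward__canonical__measure_function_Measure mu mT.
apply: (@lebesgue_rV_unique m) => // A mA; rewrite /m /= /pushforward.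
rewrite (_ : _ @^-1` _ = rV_box (fun j => f ((s^-1)%g j) @^-1` A ((s^-1)%g j))).
  rewrite [LHS]lebesgue_rV_box => [|i]; last by rewrite -[X in measurable X]setTI;
    exact: (mf _ measurableT _ (mA _)).
  rewrite [RHS](reindex_inj (@perm_inj _ s^-1%g)).
  by apply: eq_bigr => i _; exact: (fE _ _ (mA _)).
apply/seteqP; split => x /= xA i.
  by have := xA ((s^-1)%g i); rewrite mxE permKV.
by rewrite mxE; have := xA (s i); rewrite permK.
Qed.

End LebesgueInvariance.

Lemma lebesgue_measureD (R : realType) (a : R) (A : set R) : measurable A ->
  @lebesgue_measure R ((fun x => x + a) @^-1` A) = lebesgue_measure A.
Proof.
move=> mA.
have mD : measurable_fun setT (fun x : R => x + a : measurableTypeR R) by exact: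
  measurable_funD.
pose m := measure_function_pushforward__canonical__measure_function_Measure
  (@lebesgue_measure R) mD.
apply/esym/(@lebesgue_measure_unique R m) => //= _ [[b c]] _ <-; rewrite /pushforward.
rewrite (_ : _ @^-1` _ = `]b - a, c - a]%classic).
  by rewrite !lebesgue_measure_itv/= !lte_fin ltrD2r; case: ifP => // _; rewrite -!EFinB;
    congr EFin; ring.
by apply/seteqP; split => x /=; rewrite !in_itv/= ltrBlDr lerBrDr.
Qed.

Section LebesgueIsometries.
Context {R : realType} {n : nat}.
Local Notation mu := (lebesgue_rV R n).

Lemma lebesgue_rVD (z : 'rV[R]_n) B : measurable B ->
  mu ((fun x => z + x) @^-1` B) = mu B.
Proof.
move=> mB; have -> : (fun x => z + x) = row_permmap 1%g (fun i a => a + z ord0 i).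
  by apply/funext => x; apply/rowP => i; rewrite !mxE perm1 addrC.
apply: lebesgue_rV_permmap => //.
- by move=> i; exact: measurable_funD.
- by move=> i A mA; exact: lebesgue_measureD.
Qed.

Definition row_flip (i : 'I_n) (x : 'rV[R]_n) : 'rV[R]_n :=
  \row_j if j == i then - x ord0 j else x ord0 j.

Definition row_swap (i k : 'I_n) (x : 'rV[R]_n) : 'rV[R]_n :=
  \row_j x ord0 (tperm i k j).

Lemma lebesgue_rV_flip i B : measurable B -> mu (row_flip i @^-1` B) = mu B.
Proof.
move=> mB.
have -> : row_flip i = row_permmap 1%g (fun j a => if j == i then - a else a).
  by apply/funext => x; apply/rowP => j; rewrite !mxE perm1.
apply: lebesgue_rV_permmap => //.
- by move=> j; case: eqP => _ //; exact: measurable_funN.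
- by move=> j A mA; case: eqP => _ //; exact: lebesgue_measureN.
Qed.

Lemma lebesgue_rV_swap i k B : measurable B -> mu (row_swap i k @^-1` B) = mu B.
Proof.
by move=> mB; exact: (@lebesgue_rV_permmap _ _ (tperm i k) (fun j a => a)).
Qed.

End LebesgueIsometries.

(** * First and second moments of Euclidean balls *)

Section BallMoments.
Context {R : realType} {n : nat}.
Local Notation mu := (lebesgue_rV R n).
Implicit Types (x y : 'rV[R]_n) (e : R).

Lemma sqnorm_ge0 x : 0 <= sqnorm x.
Proof. by apply: sumr_ge0 => i _; exact: sqr_ge0. Qed.

Lemma enorm_lt x e : 0 < e -> (enorm x < e) = (sqnorm x < e ^+ 2).
Proof.
move=> e0; have {1}-> : e = Num.sqrt (e ^+ 2) by rewrite sqrtr_sqr gtr0_norm.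
by rewrite ltr_sqrt// exprn_gt0.
Qed.

Lemma eball0E e : 0 < e -> eball 0 e = [set x : 'rV[R]_n | sqnorm x < e ^+ 2].
Proof. by move=> e0; apply/seteqP; split => x; rewrite /eball/= subr0 enorm_lt. Qed.

Lemma measurable_eball0 e : 0 < e -> measurable (eball (0 : 'rV[R]_n) e).
Proof.
move=> e0; rewrite eball0E//; apply: open_measurable_rV.
apply: (@open_comp _ _ (@sqnorm R n) [set t | t < e ^+ 2]); last exact: open_lt.
by move=> x _; exact: sqnorm_continuous.
Qed.

Lemma eball0_coord e x i : 0 < e -> eball 0 e x -> `|x ord0 i| <= e.
Proof. by move=> e0; rewrite eball0E// => /ltW; apply: coord_le_sqnorm; exact: ltW. Qed.

Lemma lebesgue_rV_cube (a b : R) : a <= b ->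
  mu [set x | forall i, x ord0 i \in `]a, b[] = ((b - a) ^+ n)%:E.
Proof.
move=> ab; rewrite [LHS](@lebesgue_rV_box R n (fun=> `]a, b[%classic))//.
rewrite (eq_bigr (fun=> (b - a)%:E)) => [|i _]; last first.
  rewrite lebesgue_measure_itv/= lte_fin; case: ltP => [//|ba].
  by rewrite (_ : a = b) ?subrr//; apply/eqP; rewrite eq_le ab.
by rewrite -[in RHS](card_ord n) -prodr_const -prodEFin.
Qed.

Lemma eball0_le_cube e : 0 < e -> (mu (eball 0 e) <= ((4 * e) ^+ n)%:E)%E.
Proof.
move=> e0; rewrite (_ : 4 * e = 2 * e - - (2 * e)); last by ring.
rewrite -lebesgue_rV_cube; last by lra.
apply: le_measure; rewrite ?inE.
- exact: measurable_eball0.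
- exact: (@measurable_box R n (fun=> `]- (2 * e), (2 * e)[%classic)).
- move=> x xe i; rewrite in_itv/= -ltr_norml.
  by rewrite (le_lt_trans (eball0_coord i e0 xe))//; lra.
Qed.

(** The cube avoids the hyperplanes [x_i = 0], so that [x_i^2 >= (e / (2 n))^2] on it for every [i],
    which bounds the second moments of the ball from below. *)
Definition inner_cube e : set 'rV[R]_n :=
  [set x | forall i, x ord0 i \in `]e / (2 * n%:R), e / n%:R[].

Lemma measurable_inner_cube e : measurable (inner_cube e).
Proof. exact: (@measurable_box R n (fun=> `]e / (2 * n%:R), e / n%:R[%classic)). Qed.

Lemma inner_cube_sub e : (0 < n)%N -> 0 < e -> inner_cube e `<=` eball 0 e.
Proof.
move=> n0 e0 x xQ; rewrite eball0E//= /sqnorm.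
have N0 : 0 < n%:R :> R by rewrite ltr0n.
apply: (@lt_le_trans _ _ (\sum_(i < n) (e / n%:R) ^+ 2)).
  apply: ltr_sum => [|i _]; first by apply/hasP; exists (Ordinal n0);
    rewrite ?mem_index_enum.
  have := xQ i; rewrite in_itv/= => /andP[x1 x2].
  have : 0 < x ord0 i by apply: lt_trans x1; rewrite divr_gt0// mulr_gt0.
  by move=> x0; rewrite ltrXn2r// ltW.
rewrite sumr_const card_ord -[leLHS]mulr_natl expr_div_n mulrCA.
rewrite ler_piMr ?sqr_ge0// expr2 invfM mulrA divff ?gt_eqF// mul1r.
by rewrite invf_le1// ler1n.
Qed.

Lemma lebesgue_inner_cube e : (0 < n)%N -> 0 < e ->
  mu (inner_cube e) = ((e / (2 * n%:R)) ^+ n)%:E.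
Proof.
move=> n0 e0; have N0 : 0 < n%:R :> R by rewrite ltr0n.
rewrite lebesgue_rV_cube.
  by congr ((_ ^+ _)%:E); field; rewrite gt_eqF.
by rewrite ler_pM2l// lef_pV2 ?posrE ?mulr_gt0//; lra.
Qed.

(* The ball of radius [e] contains [inner_cube e], of side [e / (2 n)], and lies
   in a cube of side [4 e]. *)
Definition moment_cst : R := (2 * n%:R) ^- 2 * (8 * n%:R) ^- n.

Lemma moment_cst_gt0 : (0 < n)%N -> 0 < moment_cst.
Proof.
by move=> n0; rewrite mulr_gt0// invr_gt0 exprn_gt0// mulr_gt0// ltr0n.
Qed.

Lemma eball0_fin e : 0 < e -> mu (eball 0 e) \is a fin_num.
Proof.
move=> e0; rewrite ge0_fin_numE ?measure_ge0//.
exact: le_lt_trans (eball0_le_cube e0) (ltry _).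
Qed.

Lemma eball0_gt0 e : (0 < n)%N -> 0 < e -> 0 < fine (mu (eball 0 e)).
Proof.
move=> n0 e0; rewrite -lte_fin fineK ?eball0_fin//.
apply: (@lt_le_trans _ _ (mu (inner_cube e))).
  rewrite lebesgue_inner_cube// lte_fin exprn_gt0// divr_gt0// mulr_gt0// ltr0n//.
apply: le_measure; rewrite ?inE; [exact: measurable_inner_cube|exact: measurable_eball0|].
exact: inner_cube_sub.
Qed.

Lemma polyfun_continuous (f : 'rV[R]_n -> R) : polyfun f -> continuous f.
Proof. by move=> pf; apply: jet2_continuous => x; exact: polyfun_jet2. Qed.

Lemma polyfun_integrable (f : 'rV[R]_n -> R) e : 0 < e -> polyfun f ->
  mu.-integrable (eball 0 e) (EFin \o f).
Proof.
move=> e0 pf; have cf := polyfun_continuous pf.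
apply: measurable_bounded_integrable.
- exact: measurable_eball0.
- by rewrite -ge0_fin_numE ?measure_ge0// eball0_fin.
- by apply: measurable_funTS; exact: measurable_continuous_rV.
have /compact_bounded[M [Mr HM]] : compact (f @` [set x | sqnorm x <= e ^+ 2]).
  apply: continuous_compact; last exact: compact_sqball.
  exact: continuous_subspaceT.
exists M; split => // r /HM fr x xe; apply: fr; exists x => //=.
by move: xe; rewrite eball0E//= => /ltW.
Qed.

Lemma polyfun_sum (I : Type) (s : seq I) (f : I -> 'rV[R]_n -> R) :
  (forall i, polyfun (f i)) -> polyfun (fun x => \sum_(i <- s) f i x).
Proof.
move=> pf; elim: s => [|i s IHs].
  by rewrite (_ : (fun x => _) = fun=> 0) => [|]; [exact: polyfun_cst|apply/funext => x;
    rewrite big_nil].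
rewrite (_ : (fun x => _) = fun x => f i x + \sum_(j <- s) f j x); first exact: polyfunD.
by apply/funext => x; rewrite big_cons.
Qed.

Lemma Rintegral_polyfun_sum (I : Type) (s : seq I) (f : I -> 'rV[R]_n -> R) e :
  0 < e -> (forall i, polyfun (f i)) ->
  \int[mu]_(x in eball 0 e) (\sum_(i <- s) f i x) =
  \sum_(i <- s) \int[mu]_(x in eball 0 e) f i x.
Proof.
move=> e0 pf; elim: s => [|i s IHs].
  rewrite big_nil; transitivity (\int[mu]_(x in eball 0 e) (cst 0 x : R)).
    by apply: eq_Rintegral => x _; rewrite big_nil.
  by rewrite Rintegral_cst ?mul0r//; exact: measurable_eball0.
rewrite big_cons -IHs -RintegralD.
- by apply: eq_Rintegral => x _; rewrite big_cons.
- exact: measurable_eball0.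
- exact: polyfun_integrable.
- exact/polyfun_integrable/polyfun_sum.
Qed.

Lemma Rintegral_isometry (T : 'rV[R]_n -> 'rV[R]_n) (f g : 'rV[R]_n -> R) e :
  0 < e -> measurable_fun setT T ->
  (forall B, measurable B -> mu (T @^-1` B) = mu B) ->
  (forall x, sqnorm (T x) = sqnorm x) -> polyfun f -> polyfun g -> f \o T =1 g ->
  \int[mu]_(x in eball 0 e) f x = \int[mu]_(x in eball 0 e) g x.
Proof.
move=> e0 mT muT sT pf pg fTg.
have TD : T @^-1` eball 0 e = eball 0 e.
  by rewrite eball0E//; apply/seteqP; split => x /=; rewrite sT.
have gE : g = f \o T by apply/funext => x; rewrite fTg.
rewrite /Rintegral; congr fine.
transitivity (\int[pushforward mu T]_(x in eball 0 e) (f x)%:E)%E.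
  by apply: eq_measure_integral => A mA _; exact/esym/muT.
rewrite integral_pushforward//.
- by rewrite TD gE.
- apply/measurable_EFinP; apply: measurable_continuous_rV.
  exact: polyfun_continuous.
- by rewrite TD -compA -gE; exact: polyfun_integrable.
- exact: measurable_eball0.
Qed.

Lemma sqnorm_flip i x : sqnorm (row_flip i x) = sqnorm x.
Proof. by apply: eq_bigr => j _; rewrite mxE; case: ifP => // _; rewrite sqrrN. Qed.

Lemma sqnorm_swap i k x : sqnorm (row_swap i k x) = sqnorm x.
Proof.
rewrite /sqnorm [RHS](reindex_inj (@perm_inj _ (tperm i k))).
by apply: eq_bigr => j _; rewrite mxE.
Qed.

Lemma measurable_row_flip (i : 'I_n) : measurable_fun setT (@row_flip R n i).
Proof.
apply: measurable_fun_rV => j; apply: measurable_continuous_rV.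
rewrite (_ : (fun x => _) = fun x => (if j == i then -1 else 1) * x ord0 j).
  apply: polyfun_continuous; apply: polyfunM; first exact: polyfun_cst.
  exact: polyfun_coord.
by apply/funext => x; rewrite mxE; case: ifP => _; rewrite ?mulN1r ?mul1r.
Qed.

Lemma measurable_row_swap (i k : 'I_n) : measurable_fun setT (@row_swap R n i k).
Proof.
apply: measurable_fun_rV => j; apply: measurable_continuous_rV.
rewrite (_ : (fun x => _) = fun x => x ord0 (tperm i k j)).
  exact/polyfun_continuous/polyfun_coord.
by apply/funext => x; rewrite mxE.
Qed.

Lemma polyfun_mul_coord (i k : 'I_n) : polyfun (fun x : 'rV[R]_n => x ord0 i * x ord0 k).
Proof. by apply: polyfunM; exact: polyfun_coord. Qed.

Lemma first_moment e i : 0 < e -> \int[mu]_(x in eball 0 e) (x ord0 i) = 0.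
Proof.
move=> e0; set I := (LHS); suff : I = - I by lra.
rewrite -mulN1r /I -RintegralZl//; last 2 first.
- exact: measurable_eball0.
- by apply: polyfun_integrable => //; exact: polyfun_coord.
apply: (@Rintegral_isometry (row_flip i)) => //.
- exact: measurable_row_flip.
- exact: lebesgue_rV_flip.
- exact: sqnorm_flip.
- exact: polyfun_coord.
- by apply: polyfunM; [exact: polyfun_cst|exact: polyfun_coord].
- by move=> x /=; rewrite mxE eqxx mulN1r.
Qed.

Lemma mixed_moment e i k : 0 < e -> i != k ->
  \int[mu]_(x in eball 0 e) (x ord0 i * x ord0 k) = 0.
Proof.
move=> e0 ik; set I := (LHS); suff : I = - I by lra.
rewrite -mulN1r /I -RintegralZl//; last 2 first.
- exact: measurable_eball0.
- by apply: polyfun_integrable => //; exact: polyfun_mul_coord.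
apply: (@Rintegral_isometry (row_flip i)) => //.
- exact: measurable_row_flip.
- exact: lebesgue_rV_flip.
- exact: sqnorm_flip.
- exact: polyfun_mul_coord.
- by apply: polyfunM; [exact: polyfun_cst|exact: polyfun_mul_coord].
- by move=> x /=; rewrite !mxE eqxx eq_sym (negbTE ik) mulN1r mulNr.
Qed.

Lemma second_moment_eq e i k : 0 < e ->
  \int[mu]_(x in eball 0 e) (x ord0 i * x ord0 i) =
  \int[mu]_(x in eball 0 e) (x ord0 k * x ord0 k).
Proof.
move=> e0; apply: (@Rintegral_isometry (row_swap i k)) => //.
- exact: measurable_row_swap.
- exact: lebesgue_rV_swap.
- exact: sqnorm_swap.
- exact: polyfun_mul_coord.
- exact: polyfun_mul_coord.
- by move=> x /=; rewrite !mxE tpermL.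
Qed.

Lemma second_moment_le e i : 0 < e ->
  \int[mu]_(x in eball 0 e) (x ord0 i * x ord0 i) <= e ^+ 2 * fine (mu (eball 0 e)).
Proof.
move=> e0; rewrite -Rintegral_cst; last exact: measurable_eball0.
apply: le_Rintegral.
- exact: measurable_eball0.
- by apply: polyfun_integrable => //; exact: polyfun_mul_coord.
- by apply: polyfun_integrable => //; exact: polyfun_cst.
- move=> x xe; rewrite -expr2 -real_normK ?num_real// lerXn2r ?nnegrE ?(ltW e0)//.
  exact: eball0_coord.
Qed.

Lemma second_moment_ge e i : 0 < e ->
  moment_cst * e ^+ 2 * fine (mu (eball 0 e)) <=
  \int[mu]_(x in eball 0 e) (x ord0 i * x ord0 i).
Proof.
move=> e0; have n0 : (0 < n)%N := leq_ltn_trans (leq0n i) (ltn_ord i).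
have N0 : 0 < n%:R :> R by rewrite ltr0n.
have iI : mu.-integrable (eball 0 e) (EFin \o (fun x => x ord0 i * x ord0 i)).
  by apply: polyfun_integrable => //; exact: polyfun_mul_coord.
rewrite -lee_fin /Rintegral fineK; last first.
  by apply: integrable_fin_num => //; exact: measurable_eball0.
apply: (@le_trans _ _ (\int[mu]_(x in inner_cube e) (x ord0 i * x ord0 i)%:E)%E);
  last first.
  apply: ge0_subset_integral; [exact: measurable_inner_cube|exact: measurable_eball0| |
    |exact: inner_cube_sub].
    by have /integrableP[] := iI.
  by move=> x _; rewrite lee_fin -expr2 sqr_ge0.
apply: (@le_trans _ _ (\int[mu]_(x in inner_cube e) (((e / (2 * n%:R)) ^+ 2)%:E))%E);
  last first.
  apply: ge0_le_integral.
  - exact: measurable_inner_cube.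
  - by move=> x _; rewrite lee_fin sqr_ge0.
  - exact: measurable_cst.
  - have /integrableP[mI _] := iI; apply: measurable_funS mI;
    first exact: measurable_eball0.
    exact: inner_cube_sub.
  - move=> x xQ; rewrite lee_fin -expr2.
    have := xQ i; rewrite in_itv/= => /andP[x1 _].
    have h0 : 0 <= e / (2 * n%:R) by rewrite divr_ge0 ?mulr_ge0 ?ltW.
    by rewrite lerXn2r ?nnegrE// ltW// (le_lt_trans h0).
rewrite integral_cst; last exact: measurable_inner_cube.
rewrite [X in (_ * X)%E]lebesgue_inner_cube// -EFinM lee_fin.
apply: (@le_trans _ _ (moment_cst * e ^+ 2 * (4 * e) ^+ n)).
  apply: ler_wpM2l; first by apply: mulr_ge0; [exact/ltW/moment_cst_gt0|exact: sqr_ge0].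
  by rewrite -lee_fin fineK ?eball0_fin// eball0_le_cube.
have -> : 4 * e = 8 * n%:R * (e / (2 * n%:R)) by field; rewrite gt_eqF.
set a := e / (2 * n%:R); rewrite exprMn /moment_cst.
have -> : e ^+ 2 = (2 * n%:R) ^+ 2 * a ^+ 2 by rewrite -exprMn /a mulrC divfK// mulf_neq0
  ?gt_eqF.
have : (8 * n%:R) ^+ n != 0 :> R by rewrite expf_neq0// mulf_neq0// gt_eqF.
have : (2 * n%:R) ^+ 2 != 0 :> R by rewrite expf_neq0// mulf_neq0// gt_eqF.
move: ((2 * n%:R) ^+ 2) ((8 * n%:R) ^+ n) => p q p0 q0.
rewrite le_eqVlt; apply/orP; left; apply/eqP; field; exact/andP.
Qed.

End BallMoments.

(** * Comparison with harmonic functions *)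

Section LaplacianBound.
Context {R : realType} {n : nat}.
Local Notation mu := (lebesgue_rV R n).
Implicit Types (x y z : 'rV[R]_n) (e : R) (W : 'rV[R]_n -> \bar R).

Lemma polyfun_quadratic (a : R) (b : 'I_n -> R) (H : 'M[R]_n) :
  polyfun (fun y : 'rV[R]_n =>
    a + \sum_i b i * y ord0 i + \sum_i \sum_j H i j * (y ord0 i * y ord0 j)).
Proof.
apply: polyfunD; first apply: polyfunD; first exact: polyfun_cst.
  by apply: polyfun_sum => i; apply: polyfunM; [exact: polyfun_cst|exact: polyfun_coord].
apply: polyfun_sum => i; apply: polyfun_sum => j.
by apply: polyfunM; [exact: polyfun_cst|exact: polyfun_mul_coord].
Qed.

Lemma Rintegral_polyfunZ e c (f : 'rV[R]_n -> R) : 0 < e -> polyfun f ->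
  \int[mu]_(x in eball 0 e) (c * f x) = c * \int[mu]_(x in eball 0 e) f x.
Proof.
move=> e0 pf; apply: RintegralZl; first exact: measurable_eball0.
exact: polyfun_integrable.
Qed.

Lemma Rintegral_quadratic e (a : R) (b : 'I_n -> R) (H : 'M[R]_n) (k : 'I_n) : 0 < e ->
  \int[mu]_(y in eball 0 e)
    (a + \sum_i b i * y ord0 i + \sum_i \sum_j H i j * (y ord0 i * y ord0 j)) =
  a * fine (mu (eball 0 e)) +
  \tr H * \int[mu]_(y in eball 0 e) (y ord0 k * y ord0 k).
Proof.
move=> e0; have mD := @measurable_eball0 R n e e0.
have pl i : polyfun (fun y : 'rV[R]_n => b i * y ord0 i).
  by apply: polyfunM; [exact: polyfun_cst|exact: polyfun_coord].
have pq i j : polyfun (fun y : 'rV[R]_n => H i j * (y ord0 i * y ord0 j)).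
  by apply: polyfunM; [exact: polyfun_cst|exact: polyfun_mul_coord].
have psq i : polyfun (fun y : 'rV[R]_n => \sum_j H i j * (y ord0 i * y ord0 j)).
  by apply: polyfun_sum.
rewrite RintegralD//; last 2 first.
- apply: polyfun_integrable => //; apply: polyfunD; first exact: polyfun_cst.
  exact: polyfun_sum.
- by apply: polyfun_integrable => //; exact: polyfun_sum.
rewrite RintegralD//; last 2 first.
- by apply: polyfun_integrable => //; exact: polyfun_cst.
- by apply: polyfun_integrable => //; exact: polyfun_sum.
rewrite Rintegral_cst// Rintegral_polyfun_sum// big1 ?addr0 => [|i _]; last first.
  by rewrite Rintegral_polyfunZ ?first_moment ?mulr0//; exact: polyfun_coord.
congr (_ + _); rewrite Rintegral_polyfun_sum// mulr_suml; apply: eq_bigr => i _.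
rewrite Rintegral_polyfun_sum// (bigD1 i)//= big1 ?addr0 => [|j ji].
  rewrite Rintegral_polyfunZ//; last exact: polyfun_mul_coord.
  by rewrite (second_moment_eq i k).
rewrite Rintegral_polyfunZ//; last exact: polyfun_mul_coord.
by rewrite mixed_moment ?mulr0// eq_sym.
Qed.

Lemma measurable_translate z : measurable_fun setT (fun y : 'rV[R]_n => z + y).
Proof.
apply: measurable_fun_rV => i.
rewrite (_ : (fun y => _) = fun y : 'rV[R]_n => z ord0 i + y ord0 i); last first.
  by apply/funext => y; rewrite mxE.
apply: measurable_continuous_rV; apply: polyfun_continuous.
by apply: polyfunD; [exact: polyfun_cst|exact: polyfun_coord].
Qed.

Lemma sqnormD_le x y : sqnorm (x + y) <= 2 * sqnorm x + 2 * sqnorm y.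
Proof.
rewrite /sqnorm !mulr_sumr -big_split/=; apply: ler_sum => i _; rewrite mxE.
by have := sqr_ge0 (x ord0 i - y ord0 i); nra.
Qed.

(** The ball of radius [e] about [z] lies in the compact set [K], and translation invariance carries
    the integral there. *)
Lemma integrable_translate W z e : 0 < e -> locally_integrable_rV W ->
  mu.-integrable (eball 0 e) (fun y => W (z + y)).
Proof.
move=> e0 [mW iW]; apply/integrableP; split.
  by apply: measurable_funTS; apply: measurableT_comp => //; exact: measurable_translate.
pose K := [set x : 'rV[R]_n | sqnorm x <= 2 * sqnorm z + 2 * e ^+ 2].
have mK : measurable K.
  rewrite -[K]setCK; apply: measurableC; apply: open_measurable_rV.
  rewrite openC; apply: (@closed_comp _ _ (@sqnorm R n) [set t | t <= 2 * sqnorm z + 2 *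
    e ^+ 2]).
    by move=> x _; exact: sqnorm_continuous.
  exact: closed_le.
have mT := @measurable_translate z.
have mWK : measurable_fun setT (fun x => `|W x|%E) by exact: measurableT_comp.
apply: le_lt_trans _ (iW K (@compact_sqball R n _)).
have sub : (\int[mu]_(y in eball 0 e) `|W (z + y)%R| <=
    \int[mu]_(y in (fun y => (z + y)%R) @^-1` K) `|W (z + y)%R|)%E.
  apply: ge0_subset_integral => //.
  - exact: measurable_eball0.
  - by rewrite -[X in measurable X]setTI; exact: mT.
  - apply: measurable_funTS; exact: (measurableT_comp mWK mT).
  - move=> y; rewrite eball0E// /K/= => /ltW ye.
    by rewrite (le_trans (sqnormD_le _ _))// lerD2l ler_pM2l.
apply: le_trans sub _; rewrite -(@ge0_integral_pushforward _ _ _ _ R _ mT mu K (fun x =>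
  `|W x|%E))//; last first.
  exact: measurable_funTS.
rewrite le_eqVlt; apply/orP; left; apply/eqP.
by apply: eq_measure_integral => B mB _; exact: lebesgue_rVD.
Qed.

(* Near a point where a function with 2-jet of trace [t] touches [W] from below,
   odd moments cancel and each [H i i] is weighted by the same second moment, so
   the averages of [W] exceed [W x] by at least [t] times that moment. *)
Lemma laplacian0_ge W x (r : R) (g : 'rV[R]_n -> R) x0 b t (e0 : R) :
  (0 < n)%N -> locally_integrable_rV W -> W x = r%:E ->
  jet2 g x0 b t -> 0 < e0 ->
  (forall y, sqnorm y < e0 -> ((r + (g (x0 + y) - g x0))%:E <= W (x + y)%R)%E) ->
  ((2 * (n%:R + 2) * Num.min t (@moment_cst R n * t))%:E <= laplacian0 W x)%E.
Proof.
move=> n0 iW Wx [H [M [Ht M0 HM]]] e00 gW; pose k := Ordinal n0.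
apply/lee_subgt0Pr => eta eta0.
pose c := 2 * (n%:R + 2) : R.
have c0 : 0 < c by rewrite mulr_gt0// ltr_wpDl.
(* The three bounds serve the jet expansion, which needs [e <= 1], the touching condition, which
   needs [e^2 < e0], and the cubic remainder, which contributes [c M e <= eta] after division by
   [e^2]. *)
pose e1 := Num.min 1 (Num.min (Num.sqrt e0) (eta / (c * (M + 1)))).
have M1 : 0 < M + 1 by rewrite ltr_wpDl.
have e10 : 0 < e1 by rewrite !lt_min ltr01 sqrtr_gt0 e00 divr_gt0// mulr_gt0.
rewrite /laplacian0 limf_einfE.
apply: (@le_trans _ _ (ereal_inf ((fun eps => laplacian_eps eps W x) @` `]0, e1[)));
  last first.
  apply: ereal_sup_ubound; exists (`]0, e1[%classic) => //=.
  near=> e; rewrite /= in_itv/=; apply/andP; split; near: e.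
    exact: nbhs_right_gt.
  exact: nbhs_right_lt.
apply: le_ereal_inf_tmp => _ [e /= + <-]; rewrite in_itv/= => /andP[ep].
rewrite !lt_min => /andP[e1' /andP[ee0 eeta]].
have e2 : e ^+ 2 < e0.
  by rewrite -(sqr_sqrtr (ltW e00)) ltrXn2r// ltW.
have Me : c * M * e <= eta.
  move: eeta; rewrite ltr_pdivlMr ?mulr_gt0// => /ltW; apply: le_trans.
  have : 0 <= e * c by rewrite mulr_ge0 ?ltW.
  by lra.
have mD := @measurable_eball0 R n e ep.
set v := fine (mu (eball 0 e)); have v0 : 0 < v by exact: eball0_gt0.
have vE : mu (eball 0 e) = v%:E by rewrite fineK// eball0_fin.
pose S := \int[mu]_(y in eball 0 e) (y ord0 k * y ord0 k).
have S1 : S <= e ^+ 2 * v by exact: second_moment_le.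
have S2 : @moment_cst R n * e ^+ 2 * v <= S by exact: second_moment_ge.
pose G y := (r - M * e ^+ 3) + \sum_i b i * y ord0 i + \sum_i \sum_j H i j * (y ord0 i *
  y ord0 j).
have iG : mu.-integrable (eball 0 e) (EFin \o G).
  by apply: polyfun_integrable => //; exact: polyfun_quadratic.
have GW : (((r - M * e ^+ 3) * v + t * S)%:E <= \int[mu]_(y in eball 0 e) W (x + y)%R)%E.
  rewrite -Ht /S -(Rintegral_quadratic _ b)// -/G /Rintegral fineK; last first.
    by apply: integrable_fin_num.
  apply: le_integral => //; first exact: integrable_translate.
  move=> y; rewrite inE => ye; apply: le_trans (gW y _); last first.
    by move: ye; rewrite eball0E//= => /lt_trans; apply.
  have e01 : 0 <= e <= 1 by rewrite !ltW.
  have := HM e y e01 (fun i => eball0_coord i ep ye).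
  rewrite lee_fin /G; by rewrite ler_norml => /andP[+ _]; lra.
rewrite /laplacian_eps Wx; rewrite (_ : (r%:E == +oo%E) = false)// /ball_average vE inver
  gt_eqF//.
apply: (@le_trans _ _ ((c / e ^+ 2)%:E * ((v^-1)%:E * ((r - M * e ^+ 3) * v + t * S)%:E -
  r%:E)))%E; last first.
  apply: lee_wpmul2l; first by rewrite lee_fin divr_ge0// ?sqr_ge0// ltW.
  by apply: leeB => //; apply: lee_wpmul2l => //; rewrite lee_fin invr_ge0 ltW.
change ((c * Num.min t (@moment_cst R n * t) - eta)%:E <=
  (c / e ^+ 2 * (v^-1 * ((r - M * e ^+ 3) * v + t * S) - r))%:E)%E; rewrite lee_fin.
have -> : c / e ^+ 2 * (v^-1 * ((r - M * e ^+ 3) * v + t * S) - r) =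
    c * (t * (S / (e ^+ 2 * v))) - c * M * e by field; rewrite !gt_eqF.
rewrite lerB// ler_pM2l//.
have ev : 0 < e ^+ 2 * v by rewrite mulr_gt0// exprn_gt0.
have s1 : S / (e ^+ 2 * v) <= 1 by rewrite ler_pdivrMr// mul1r.
have s2 : @moment_cst R n <= S / (e ^+ 2 * v) by rewrite ler_pdivlMr// mulrA.
(* The normalised moment [S / (e^2 v)] lies between [moment_cst] and 1; the worst case for [t] times
   it is the lower end if [t >= 0] and the upper end otherwise. *)
have [t0|t0] := leP 0 t; rewrite ge_min; apply/orP; [right|left].
  by rewrite mulrC ler_wpM2l.
by have := s1; nra.
Unshelve. all: by end_near.
Qed.

End LaplacianBound.

(** * Comparison on balls under one-sided bounds on the generalised Laplacian *)

Section Comparison.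
Context {R : realType} {n : nat}.
Hypothesis n0 : (0 < n)%N.
Local Notation mu := (lebesgue_rV R n).
Local Notation m2 := (@moment_cst R n).
Implicit Types (x y z : 'rV[R]_n) (W : 'rV[R]_n -> \bar R).

Lemma sqnorm_interior x (r : R) : sqnorm x < r ->
  exists2 e, 0 < e & forall y, sqnorm y < e -> sqnorm (x + y) <= r.
Proof.
move=> xr; pose d := r - sqnorm x; have d0 : 0 < d by rewrite subr_gt0.
have x1 : 0 < sqnorm x + 1 by rewrite ltr_wpDl// sqnorm_ge0.
(* Parameter of the Young inequality [|x + y|^2 <= (1 + a) |x|^2 + (1 + 1/a) |y|^2], small enough
   that [a |x|^2 <= d / 2]. *)
pose a := d / (2 * (sqnorm x + 1)); have a0 : 0 < a by rewrite divr_gt0// mulr_gt0.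
have ia : 0 < 1 + a^-1 by rewrite addr_gt0// invr_gt0.
exists (d / (2 * (1 + a^-1))); first by rewrite divr_gt0// mulr_gt0.
move=> y; rewrite ltr_pdivlMr ?mulr_gt0// => yd.
apply: (@le_trans _ _ ((1 + a) * sqnorm x + (1 + a^-1) * sqnorm y)).
  rewrite /sqnorm !mulr_sumr -big_split/=; apply: ler_sum => i _; rewrite mxE.
  set u := x ord0 i; set v := y ord0 i.
  have := mulr_ge0 (ltW a0) (sqr_ge0 (u - v / a)).
  have -> : a * (u - v / a) ^+ 2 = a * u ^+ 2 - 2 * u * v + a^-1 * v ^+ 2.
    by field; rewrite gt_eqF.
  by lra.
have : a * sqnorm x <= d / 2.
  rewrite /a mulrAC ler_pdivrMr ?mulr_gt0//.
  rewrite (_ : d / 2 * _ = d * sqnorm x + d); first by rewrite lerDl ltW.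
  by field.
rewrite /d in yd *; lra.
Qed.

Lemma lsc_translate W z : lower_semicontinuous W ->
  lower_semicontinuous (fun y => W (z + y)).
Proof.
move=> Wlsc x a aW; have [V /nbhs_ballP[e /= e0 eV] Va] := Wlsc _ _ aW.
exists (ball x e); first exact: nbhsx_ballx.
move=> y [_ xy]; apply/Va/eV; split => // i j.
by have := xy i j; rewrite /ball/= !mxE opprD addrACA subrr add0r.
Qed.

Lemma ball_comparison W z (rho A : R) (h : 'rV[R]_n -> R) :
  lower_semicontinuous W -> (forall x, -oo < W x)%E -> locally_integrable_rV W ->
  0 < rho -> harmfun h ->
  (forall x, sqnorm x = rho -> ((h x)%:E <= W (z + x)%R)%E) ->
  (forall x, sqnorm x < rho -> (laplacian0 W (z + x)%R <
     (2 * (n%:R + 2) * Num.min (A * n%:R) (m2 * (A * n%:R)))%:E)%E) ->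
  ((h 0%R)%:E <= W z + (A * rho)%:E)%E.
Proof.
move=> Wlsc WNy iW rho0 hh hW lapW; rewrite leNgt; apply/negP => lt0.
(* The barrier [g = h - A (rho - |.|^2)] equals [h] on the sphere and, if the claim fails, exceeds
   [W] at the centre. Its half-Laplacian is [A n], which explains the threshold on
   [laplacian0 W]. *)
pose h' y := h y + (- (A * rho)).
pose g y := h' y + A * sqnorm y.
have hh' : harmfun h' by apply: harmfunD => //; exact: harmfun_cst.
have cg : continuous g.
  by apply: jet2_continuous => x; have [b jb] := harmfun_jet2 A x hh'; exists b; eexists;
    exact: jb.
pose u y := W (z + y).
have uNy y : (-oo < u y)%E by exact: WNy.
have gS y : sqnorm y = rho -> ((g y)%:E <= u y)%E.
  by move=> yr; rewrite /g /h' yr subrK; exact: hW.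
have u0 : (u 0%R < (g 0%R)%:E)%E.
  by rewrite /u addr0 /g /h' sqnorm0 mulr0 addr0 EFinB lteBrDr.
have [x [s [xrho us] gu]] := touching_point (@lsc_translate W z Wlsc) uNy cg rho0 gS u0.
have [e e0 eP] := sqnorm_interior xrho.
have [b jb] := harmfun_jet2 A x hh'.
have touch y : sqnorm y < e -> ((s + (g (x + y) - g x))%:E <= W (z + x + y)%R)%E.
  by move=> /eP/gu; rewrite /u (addrA z).
have := laplacian0_ge n0 iW us jb e0 touch.
by rewrite leNgt lapW.
Qed.

Lemma ball_comparison_pos : exists2 a, 0 < a & forall W z (rho K : R) (h : 'rV[R]_n -> R),
  lower_semicontinuous W -> (forall x, -oo < W x)%E -> locally_integrable_rV W ->
  0 < rho -> harmfun h ->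
  (forall x, sqnorm x = rho -> ((h x)%:E <= W (z + x)%R)%E) ->
  0 < K -> (forall x, (laplacian0 W x <= K%:E)%E) ->
  ((h 0%R)%:E <= W z + (a * K * rho)%:E)%E.
Proof.
have N0 : 0 < n%:R :> R by rewrite ltr0n.
have m0 := @moment_cst_gt0 R n n0.
(* With [A = a K] this gives [t = (1 + 1/m2) K / (n + 2)], for which [2 (n + 2) t] and
   [2 (n + 2) m2 t] both exceed [2 K]. *)
exists ((1 + m2^-1) / (n%:R * (n%:R + 2))).
  by rewrite divr_gt0 ?addr_gt0 ?mulr_gt0 ?invr_gt0// ltr_wpDl.
move=> W z rho K h Wlsc WNy iW rho0 hh hW K0 lapW.
apply: ball_comparison => // x _; apply: le_lt_trans (lapW _) _; rewrite lte_fin.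
have n2 : n%:R + 2 != 0 :> R by rewrite gt_eqF// ltr_wpDl.
set t := _ * n%:R.
have -> : t = (1 + m2^-1) * K / (n%:R + 2).
  by rewrite /t; field; rewrite n2 !gt_eqF.
rewrite minEle; case: ifP => _.
  rewrite [ltRHS](_ : _ = 2 * K + 2 * K / m2); last by field; rewrite n2 !gt_eqF.
  have : 0 < 2 * K / m2 by rewrite divr_gt0// mulr_gt0.
  by lra.
move: (m2) m0 => m m0.
rewrite [ltRHS](_ : _ = 2 * K + 2 * K * m); last by field; rewrite n2 !gt_eqF.
have : 0 < 2 * K * m by rewrite !mulr_gt0.
by lra.
Qed.

Lemma ball_comparison_neg : exists2 a, 0 < a & forall W z (rho K : R) (h : 'rV[R]_n -> R),
  lower_semicontinuous W -> (forall x, -oo < W x)%E -> locally_integrable_rV W ->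
  0 < rho -> harmfun h ->
  (forall x, sqnorm x = rho -> ((h x)%:E <= W (z + x)%R)%E) ->
  0 < K -> (forall x, sqnorm x < rho -> (laplacian0 W (z + x)%R <= (- K)%:E)%E) ->
  ((h 0%R)%:E <= W z - (a * K * rho)%:E)%E.
Proof.
have N0 : 0 < n%:R :> R by rewrite ltr0n.
have m0 := @moment_cst_gt0 R n n0.
(* With [A = - a K] this gives [t = - K / (4 (n + 2) (1 + m2))], for which [2 (n + 2) t] and
   [2 (n + 2) m2 t] are both at least [- K / 2], hence above [- K]. *)
exists (4 * n%:R * (n%:R + 2) * (1 + m2))^-1.
  by rewrite invr_gt0 !mulr_gt0 ?addr_gt0// ltr_wpDl.
move=> W z rho K h Wlsc WNy iW rho0 hh hW K0 lapW.
rewrite -EFinN -mulNr; apply: ball_comparison => // x xr.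
apply: le_lt_trans (lapW _ xr) _; rewrite lte_fin.
have n2 : n%:R + 2 != 0 :> R by rewrite gt_eqF// ltr_wpDl.
have m1 : 1 + m2 != 0 by rewrite gt_eqF// addr_gt0.
set t := _ * n%:R.
have -> : t = - K / (4 * (n%:R + 2) * (1 + m2)).
  by rewrite /t; field; rewrite n2 m1 !gt_eqF.
have q1 : (1 + m2)^-1 <= 1 by rewrite invf_le1 ?addr_gt0// lerDl ltW.
have q2 : m2 / (1 + m2) <= 1 by rewrite ler_pdivrMr ?addr_gt0//; lra.
rewrite minEle; case: ifP => _.
  rewrite [ltRHS](_ : _ = - K * (1 + m2)^-1 / 2); last by field; rewrite n2 m1.
  by nra.
rewrite [ltRHS](_ : _ = - K * (m2 / (1 + m2)) / 2); last by field; rewrite n2 m1.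
by nra.
Qed.

End Comparison.

(** * Minimisers *)

Section FiniteEnergy.
Context {R : realType} {n : nat}.
Hypothesis n0 : (0 < n)%N.
Local Notation mu := (lebesgue_rV R n).
Variable W : 'rV[R]_n -> \bar R.
Hypothesis iW : locally_integrable_rV W.

Lemma negligible_pole : mu.-negligible [set x | W x = +oo%E].
Proof.
have [mW fW] := iW.
have K k : mu.-negligible [set x | sqnorm x < k.+1%:R ^+ 2 /\ W x = +oo%E].
  have k0 : 0 < k.+1%:R :> R by [].
  have mD := @measurable_eball0 R n _ k0.
  have iD : mu.-integrable (eball 0 k.+1%:R) W.
    have := integrable_translate 0 k0 iW; under eq_fun do rewrite add0r.
    by [].
  apply: negligibleS (integrable_ae mD iD) => x /= [xk Wx] /(_ _).
  by rewrite eball0E//= xk Wx => /(_ isT).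
apply: negligibleS (negligible_bigcup K) => x /= Wx.
exists (Num.truncn (sqnorm x)) => //; split => //.
have := truncnS_gt (sqnorm x) => xt; apply: (lt_le_trans xt).
by rewrite expr2 ler_peMr// ler1n.
Qed.

Lemma negligible_pole_translate a : mu.-negligible [set x | W (x - a) = +oo%E].
Proof.
have [B [mB B0 PB]] := negligible_pole.
exists ((fun x => - a + x) @^-1` B); split.
- by rewrite -[X in measurable X]setTI; exact: (measurable_translate (- a)).
- by rewrite lebesgue_rVD.
- by move=> x /= Wx; apply: PB; rewrite /= addrC.
Qed.

Lemma rV_not_negligible : ~ mu.-negligible [set: 'rV[R]_n].
Proof.
move=> [B [mB B0 TB]]; have := @eball0_gt0 R n 1 n0 ltr01.
rewrite (_ : mu _ = 0%E) ?ltxx//; apply/eqP; rewrite eq_le measure_ge0 andbT -B0.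
apply: le_measure; rewrite ?inE//; first exact: measurable_eball0.
by move=> x _; exact: TB.
Qed.

(** Points are chosen one at a time: the forbidden positions form a finite union of translates of
    the null set where [W] is infinite. The resulting configuration is the competitor that forces
    minimisers to have finite energy. *)
Lemma exists_pairwise_finite (m : nat) : exists2 s : seq 'rV[R]_n,
  size s = m & pairwise (fun x y => W (x - y) != +oo%E) s.
Proof.
elim: m => [|m [s sm sW]]; first by exists [::].
suff [x xs] : exists x, all (fun y => W (x - y) != +oo%E) s.
  by exists (x :: s) => /=; [rewrite sm|rewrite xs].
apply: contrapT => nx; apply: rV_not_negligible.
apply: (@negligibleS _ _ _ mu [set x | has (fun y => W (x - y) == +oo%E) s]).
  move=> x _ /=; apply: contrapT => /negP nh; apply: nx; exists x.
  by have := all_predC (fun y => W (x - y) == +oo%E) s; rewrite nh.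
elim: (s) => [|y t IHt] /=; first by exists set0; split => //; exact: measure0.
apply: negligibleS (negligibleU (negligible_pole_translate y) IHt) => x /=.
by case/orP => [/eqP|]; [left|right].
Qed.

End FiniteEnergy.

Section Minimisers.
Context {R : realType} {n N : nat}.
Implicit Types (X Y : 'I_N -> 'rV[R]_n).
Variable W : 'rV[R]_n -> \bar R.
Hypothesis W_sym : forall x, W (- x) = W x.
Hypothesis W_Ny : forall x, (-oo < W x)%E.
Hypothesis N2 : (2 <= N)%N.

Let cN : 0 < (2 * N%:R ^+ 2)^-1 :> R.
Proof. by rewrite invr_gt0 mulr_gt0// exprn_gt0// ltr0n; case: N N2. Qed.

Let WNy x : W x != -oo%E. Proof. by rewrite gt_eqF. Qed.

Lemma energy_fin X : (energy W X < +oo)%E <->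
  forall i j, j != i -> W (X i - X j) \is a fin_num.
Proof.
have fP x : (W x \is a fin_num) = (W x != +oo%E) by rewrite fin_numE WNy.
have iNy i : (\sum_(j < N | j != i) W (X i - X j)%R)%E != -oo%E.
  apply/eqP => /esum_eqNyP[j [_ _ /eqP]]; exact/negP/WNy.
split=> [XE i j ji|XF].
  rewrite fP; apply/eqP => Wij; move: XE; rewrite /energy.
  have -> : (\sum_(i < N) \sum_(j < N | j != i) W (X i - X j)%R)%E = +oo%E.
    apply/esum_eqyP => //; exists i; split; rewrite ?mem_index_enum//.
    by apply/esum_eqyP => //; exists j; rewrite mem_index_enum.
  by rewrite gt0_muley ?ltxx// lte_fin.
rewrite /energy lte_mul_pinfty ?lee_fin ?(ltW cN)//.
rewrite ltey; apply/eqP => /esum_eqyP[//|i [_ _]] /esum_eqyP[//|j [_ ji]] Wij.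
by have := XF i j ji; rewrite Wij.
Qed.

(** By symmetry of [W], particle [i] contributes equally as first and as second index; the last
    double sum does not involve [X i]. *)
Lemma energy_split X i : energy W X =
  ((2 * N%:R ^+ 2)^-1%:E * (\sum_(j < N | j != i) W (X i - X j)%R +
   \sum_(j < N | j != i) W (X i - X j)%R +
   \sum_(k < N | k != i) \sum_(j < N | (j != k) && (j != i)) W (X k - X j)%R))%E.
Proof.
rewrite /energy (bigD1 i)//= -addeA; congr (_ * (_ + _))%E.
rewrite -big_split/=; apply: eq_bigr => k ki.
rewrite (bigD1 i) 1?eq_sym//=; congr (_ + _)%E.
by rewrite -W_sym opprB.
Qed.

(** The competitor moves particle [i] alone by [y]. The interaction of the other particles is
    unchanged and finite, so it can be cancelled in the extended reals. *)
Lemma minimiser_potential_min X i y : minimiser W X -> (energy W X < +oo)%E ->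
  (\sum_(j < N | j != i) W (X i - X j)%R <=
   \sum_(j < N | j != i) W (X i - X j + y)%R)%E.
Proof.
move=> minX XE; have XF := (energy_fin X).1 XE.
pose Y k := if k == i then X i + y else X k.
have := minX Y; rewrite !(energy_split _ i) lee_pmul2l ?lte_fin//.
have -> : (\sum_(k < N | k != i) \sum_(j < N | (j != k) && (j != i)) W (Y k - Y j)%R =
    \sum_(k < N | k != i) \sum_(j < N | (j != k) && (j != i)) W (X k - X j)%R)%E.
  apply: eq_bigr => k ki; apply: eq_bigr => j /andP[_ ji].
  by rewrite /Y (negbTE ki) (negbTE ji).
have -> : (\sum_(j < N | j != i) W (Y i - Y j)%R =
    \sum_(j < N | j != i) W (X i - X j + y)%R)%E.
  by apply: eq_bigr => j ji; rewrite /Y eqxx (negbTE ji) addrAC.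
rewrite leeD2rE; last first.
  apply/sum_fin_numP => k _ ki; apply/sum_fin_numP => j _ /andP[jk _]; exact: XF.
have : (\sum_(j < N | j != i) W (X i - X j)%R)%E \is a fin_num.
  by apply/sum_fin_numP => j _ ji; exact: XF.
case: (\sum_(j < N | j != i) W (X i - X j)%R)%E => // a _.
case: (\sum_(j < N | j != i) W (X i - X j + y)%R)%E => [b| |]//=; rewrite ?leey//.
by rewrite -!EFinD !lee_fin; lra.
Qed.

End Minimisers.

Lemma minimiser_energy_fin (R : realType) (n N : nat) (W : 'rV[R]_n -> \bar R)
    (X : 'I_N -> 'rV[R]_n) : (0 < n)%N -> locally_integrable_rV W ->
  (forall x, W (- x) = W x) -> (forall x, -oo < W x)%E -> (2 <= N)%N ->
  minimiser W X -> (energy W X < +oo)%E.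
Proof.
move=> n0 iW W_sym WNy N2 minX.
have [s sN sW] := exists_pairwise_finite n0 iW N.
apply: le_lt_trans (minX (fun i => nth 0 s i)) _; apply/energy_fin => // i j ji.
rewrite fin_numE gt_eqF//=.
have [lt|lt|/val_inj eq] := ltngtP i j; last by rewrite eq eqxx in ji.
  by move/(pairwiseP 0) : sW; apply => //; rewrite inE sN.
rewrite -W_sym opprB.
by move/(pairwiseP 0) : sW; apply => //; rewrite inE sN.
Qed.

Section MorreyMass.
Context {R : realType} {n N : nat}.

Definition near_count (X : 'I_N -> 'rV[R]_n) i r :=
  #|[pred j | (j != i) && (enorm (X i - X j) < r)]|.

Lemma enormN (x : 'rV[R]_n) : enorm (- x) = enorm x.
Proof. by congr Num.sqrt; apply: eq_bigr => i _; rewrite mxE sqrrN. Qed.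

Lemma morrey_massE (X : 'I_N -> 'rV[R]_n) i r : 0 < r ->
  morrey_mass X i r = (N%:R^-1 * (near_count X i r)%:R)%:E.
Proof.
move=> r0; rewrite /morrey_mass /empirical_measure.
under eq_bigr do rewrite diracE.
rewrite sumEFin -EFinM -EFinB; congr EFin.
(* Particle [i] lies in its own ball and accounts for the [1 / N] that [morrey_mass] subtracts. *)
rewrite (bigD1 i)//= mem_set/=; last first.
  by rewrite /eball/= subrr /enorm big1 ?sqrtr0// => j _; rewrite mxE expr0n.
rewrite mulrDr mulr1 addrAC subrr add0r; congr (_ * _).
rewrite /near_count -sum1_card natr_sum big_mkcondr/=.
apply: eq_bigr => j ji; rewrite /eball.
rewrite [X in _ = if X then _ else _](_ : _ = (X j \in [set x | enorm (x - X i) < r]));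
  last first.
  by rewrite -enormN opprB; apply/idP/idP; rewrite inE.
by case: (_ \in _).
Qed.

End MorreyMass.

(** * Minimum principle for harmonic polynomials *)

Section MinimumPrinciple.
Context {R : realType} {n : nat}.
Hypothesis n0 : (0 < n)%N.

Lemma laplacian0_cst0 (x : 'rV[R]_n) : (laplacian0 (cst 0%E) x <= 0)%E.
Proof.
rewrite /laplacian0 limf_einfE; apply: ge_ereal_sup => _ [V V0 <-].
have [e Ve] := filter_ex V0.
apply: ereal_inf_lbound; exists e => //.
rewrite /laplacian_eps (_ : (_ == _) = false)// /ball_average.
by rewrite integral0 mule0 sube0 mule0.
Qed.

(* This is the comparison principle for the potential 0, with [K] arbitrarily
   small. *)
Lemma harmfun_ge_sphere (rho m : R) (h : 'rV[R]_n -> R) : 0 < rho -> harmfun h ->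
  (forall x, sqnorm x = rho -> m <= h x) -> m <= h 0.
Proof.
move=> rho0 hh mh.
have [a a0 cmp] := @ball_comparison_pos R n n0.
apply/ler_addgt0Pr => e e0.
(* On the sphere [m - h] lies below the potential 0; the choice [K = e / (a * rho)] turns the error
   [a K rho] into [e]. *)
have hm : harmfun (fun x => -1 * h x + m).
  by apply: harmfunD; [exact: harmfunZ|exact: harmfun_cst].
have := cmp (cst 0%E) 0 rho (e / (a * rho)) _ _ _ _ rho0 hm.
have -> : a * (e / (a * rho)) * rho = e by field; rewrite !gt_eqF.
rewrite add0e lee_fin mulN1r addrC lerBlDl; apply.
- by move=> x b b0; exists setT; [exact: filterT|move=> y _; exact: b0].
- by move=> x; rewrite ltNy0.
- split; first exact: measurable_cst.
  by move=> K _; under eq_integral do rewrite abse0; rewrite integral0.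
- by move=> x xr; rewrite lee_fin mulN1r addrC subr_le0 mh.
- by rewrite divr_gt0// mulr_gt0.
- by move=> x; rewrite (le_trans (laplacian0_cst0 x))// lee_fin divr_ge0 ?mulr_ge0 ?ltW.
Qed.

Lemma harmfun_sum (I : Type) (s : seq I) (P : pred I) (h : I -> 'rV[R]_n -> R) :
  (forall i, harmfun (h i)) -> harmfun (fun x => \sum_(i <- s | P i) h i x).
Proof.
move=> hh; elim: s => [|i s IHs].
  rewrite (_ : (fun x => _) = fun=> 0) => [|]; first exact: harmfun_cst.
  by apply/funext => x; rewrite big_nil.
rewrite (_ : (fun x => _) = fun x =>
    (if P i then 1 else 0) * h i x + \sum_(j <- s | P j) h j x); last first.
  by apply/funext => x; rewrite big_cons; case: ifP => _; rewrite ?mul1r ?mul0r ?add0r.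
by apply: harmfunD => //; exact: harmfunZ.
Qed.

Lemma enorm_sqr (x : 'rV[R]_n) : enorm x ^+ 2 = sqnorm x.
Proof. by rewrite /enorm sqr_sqrtr// sqnorm_ge0. Qed.

Lemma enorm_eq0 (x : 'rV[R]_n) : enorm x = 0 -> x = 0.
Proof.
move=> x0; have : sqnorm x = 0 by rewrite -enorm_sqr x0 expr0n.
move=> /eqP; rewrite psumr_eq0 => [/allP xi|i _]; last exact: sqr_ge0.
apply/rowP => i; rewrite mxE; apply/eqP; rewrite -sqrf_eq0.
by apply: xi; rewrite mem_index_enum.
Qed.

End MinimumPrinciple.

(** * Counting the particles near a given one *)

Section NearCount.
Context {R : realType} {n : nat}.
Hypothesis n0 : (0 < n)%N.
Variable W : 'rV[R]_n -> \bar R.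
Hypothesis W_lsc : lower_semicontinuous W.
Variable c : R.
Hypothesis W_lb : forall x, (c%:E <= W x)%E.
Hypothesis W_loc : locally_integrable_rV W.
Variables (C_W delta C beta : R).
Hypotheses (C_W_gt0 : 0 < C_W) (C_gt0 : 0 < C) (beta_gt0 : 0 < beta).
Hypothesis W_lap : forall x, (laplacian0 W x <= C_W%:E)%E.
Hypothesis W_rep : forall x, 0 < enorm x < delta ->
  ((C * enorm x `^ (- beta))%:E <= - laplacian0 W x)%E.
Hypothesis W_rep0 : (- laplacian0 W 0 = +oo)%E.

Let W_Ny x : (-oo < W x)%E. Proof. exact: lt_le_trans (ltNyr _) (W_lb x). Qed.

Lemma laplacian0_near_origin z x r : 0 < r -> 2 * r <= delta -> enorm z < r ->
  sqnorm x < r ^+ 2 -> (laplacian0 W (z + x)%R <= (- (C * (2 * r) `^ (- beta)))%:E)%E.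
Proof.
move=> r0 rd zr xr; rewrite EFinN -leeNr.
have zx : enorm (z + x) < 2 * r.
  rewrite enorm_lt ?mulr_gt0// (le_lt_trans (sqnormD_le z x))//.
  by have := zr; rewrite enorm_lt// exprMn; lra.
have := sqrtr_ge0 (sqnorm (z + x)); rewrite -/(enorm _) le_eqVlt => /orP[/eqP e0|e0].
  by rewrite [_ + x]enorm_eq0 -?e0// W_rep0 leey.
apply: le_trans (W_rep _); last by rewrite e0 (lt_le_trans zx).
rewrite lee_fin ler_pM2l// !powRN lef_pV2 ?posrE ?powR_gt0 ?mulr_gt0//.
by apply: ge0_ler_powR; rewrite ?nnegrE ?ltW// mulr_gt0.
Qed.

Lemma near_count_bound : exists2 q, 0 < q & forall N (X : 'I_N -> 'rV[R]_n) i r,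
  (forall j, j != i -> W (X i - X j) \is a fin_num) ->
  (forall y, (\sum_(j < N | j != i) W (X i - X j)%R <=
     \sum_(j < N | j != i) W (X i - X j + y)%R)%E) ->
  0 < r -> 2 * r <= delta -> (near_count X i r)%:R <= q * N%:R * r `^ beta.
Proof.
have [a a0 cmpp] := @ball_comparison_pos R n n0.
have [b b0 cmpn] := @ball_comparison_neg R n n0.
(* The inequality [sum_j A_j >= 0] yields [near_count * (b K) <= N * (a C_W)] with
   [K = C (2 r)^(- beta)]; this is what remains when it is solved for the count. *)
exists (a * C_W / (b * C) * 2 `^ beta).
  by rewrite mulr_gt0 ?powR_gt0// divr_gt0// mulr_gt0.
move=> N X i r XF Xmin r0 rd.
have r20 : 0 < r ^+ 2 by rewrite exprn_gt0.
pose K := C * (2 * r) `^ (- beta).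
have K0 : 0 < K by rewrite mulr_gt0 ?powR_gt0 ?mulr_gt0.
pose S := [set x : 'rV[R]_n | sqnorm x = r ^+ 2].
pose nr j := enorm (X i - X j) < r.
pose A j := if nr j then - (b * K) else a * C_W.
have sumA : 0 <= \sum_(j < N | j != i) A j.
  (* The values at the centre give [m - e <= sum_j h_j 0 <= m + r^2 sum_j A_j], so the sign is
     proved for the sum times [r^2], up to [e]. *)
  rewrite -(pmulr_lge0 _ r20); apply/ler_addgt0Pr => e e0.
  pose w j := fine (W (X i - X j)); pose m := \sum_(j < N | j != i) w j.
  have mE : (m%:E = \sum_(j < N | j != i) W (X i - X j)%R)%E.
    by rewrite /m -sumEFin; apply: eq_bigr => j ji; rewrite fineK// XF.
  have mS x : S x -> (m%:E <= \sum_(j < N | j != i) W (X i - X j + x)%R)%E.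
    by move=> _; rewrite mE.
  have Sr x : S x -> forall k, `|x ord0 k| <= r.
    by move=> xS k; apply: coord_le_sqnorm; [exact: ltW|rewrite [sqnorm x]xS].
  have u_lb (j : 'I_N) x : (c%:E <= W (X i - X j + x)%R)%E by exact: W_lb.
  have u_lsc (j : 'I_N) : lower_semicontinuous (fun x => W (X i - X j + x)).
    exact: lsc_translate.
  have [g [pg gW mg]] := lsc_polyfun_approx u_lb u_lsc (@compact_sqsphere R n (r ^+ 2))
    r0 Sr mS e0.
  have hP j : exists h, harmfun h /\ forall x : 'rV[R]_n, sqnorm x = r ^+ 2 -> h x = g j x.
    by have [h] := dirichlet_sphere (r ^+ 2) (pg j); exists h.
  have [h {}hP] := choice hP.
  have h_le j : j != i -> h j 0 <= w j + A j * r ^+ 2.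
    move=> ji; rewrite -lee_fin EFinD /w fineK ?XF// /A.
    have hW x : sqnorm x = r ^+ 2 -> ((h j x)%:E <= W (X i - X j + x)%R)%E.
      by move=> xr; rewrite (hP j).2//; exact: gW.
    case: ifPn => [nj|_]; last exact: cmpp W_lsc W_Ny W_loc r20 (hP j).1 hW C_W_gt0 W_lap.
    rewrite mulNr EFinN; apply: cmpn W_lsc W_Ny W_loc r20 (hP j).1 hW K0 _ => x.
    exact: laplacian0_near_origin.
  have := @harmfun_ge_sphere R n n0 (r ^+ 2) (m - e) _ r20
    (harmfun_sum (index_enum 'I_N) (fun j => j != i) (fun j => (hP j).1)).
  have hm x : sqnorm x = r ^+ 2 -> m - e <= \sum_(j < N | j != i) h j x.
    move=> xr; rewrite (le_trans (mg x xr))// ler_sum// => j _.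
    by rewrite (hP j).2.
  move=> /(_ hm) mh.
  have : \sum_(j < N | j != i) h j 0 <= m + (\sum_(j < N | j != i) A j) * r ^+ 2.
    by rewrite mulr_suml /m -big_split/=; apply: ler_sum => j ji; exact: h_le.
  by move: mh; lra.
have nE : (near_count X i r)%:R = \sum_(j < N | j != i) (nr j)%:R :> R.
  rewrite /near_count -sum1_card natr_sum big_mkcondr/=.
  by apply: eq_bigr => j _; rewrite /nr; case: (_ < _).
have sumA_le : \sum_(j < N | j != i) A j <= N%:R * (a * C_W) - (near_count X i r)%:R * (b
  * K).
  apply: (@le_trans _ _ (\sum_(j < N | j != i) (a * C_W - (nr j)%:R * (b * K)))).
    apply: ler_sum => j _; rewrite /A; case: (nr j); last by rewrite mul0r subr0.
    by rewrite mul1r -[leLHS]add0r lerD2r mulr_ge0 ?ltW.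
  rewrite sumrB -[X in _ - X <= _]mulr_suml -nE lerD2r sumr_const -[leLHS]mulr_natl.
  rewrite ler_wpM2r ?mulr_ge0 ?(ltW a0) ?(ltW C_W_gt0)// ler_nat.
  by rewrite (leq_trans (max_card _))// card_ord.
have := le_trans sumA sumA_le; rewrite subr_ge0.
have KE : K * (2 `^ beta * r `^ beta) = C.
  rewrite /K powRN powRM ?ltW// -mulrA mulVf ?mulr1//.
  by rewrite mulf_neq0// gt_eqF// powR_gt0.
have P0 : 0 < 2 `^ beta * r `^ beta :> R by rewrite mulr_gt0 ?powR_gt0.
move=> nb; have bC : 0 < b * C by rewrite mulr_gt0.
rewrite -(ler_pM2r bC).
have -> : a * C_W / (b * C) * 2 `^ beta * N%:R * r `^ beta * (b * C) =
  N%:R * (a * C_W) * (2 `^ beta * r `^ beta) by field; rewrite !gt_eqF.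
have -> : (near_count X i r)%:R * (b * C) =
  (near_count X i r)%:R * (b * K) * (2 `^ beta * r `^ beta) by rewrite -{1}KE; ring.
by rewrite ler_pM2r.
Qed.

End NearCount.

Theorem theorem4p4 (R : realType) (d : nat) (d_ge1 : (1 <= d)%N)
    (W : 'rV[R]_d -> \bar R)
    (W_sym : forall x, W (- x) = W x)
    (W_lsc : lower_semicontinuous W)
    (W_lb : exists c : R, forall x, (c%:E <= W x)%E)
    (W_loc : locally_integrable_rV W)
    (beta : R) (beta_bnd : 0 < beta < d%:R)
    (W_rep : repulsive beta W)
    (C_W : R) (C_W_gt0 : 0 < C_W)
    (W_lap : forall x, (laplacian0 W x <= C_W%:E)%E) :
  exists2 C' : R, 0 < C' &
    forall (N : nat) (X : 'I_N -> 'rV[R]_d), (2 <= N)%N -> minimiser W X ->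
      let p : \bar R := (d%:R / (d%:R - beta))%:E in
      morrey p X /\ (morrey_norm p X <= C'%:E)%E.
Proof.
have [c cW] := W_lb; have [_ [delta [C [delta0 C0 W_near W_zero]]]] := W_rep.
have /andP[beta0 _] := beta_bnd.
have [q q0 count_le] := near_count_bound d_ge1 W_lsc cW W_loc C_W_gt0 C0
  beta0 W_lap W_near W_zero.
have WNy x : (-oo < W x)%E by exact: lt_le_trans (ltNyr _) (cW x).
have t0 : 0 < (2 / delta) `^ beta by apply: powR_gt0; exact: divr_gt0.
(* The first summand serves the radii with [2 r <= delta]. For larger ones
   [(2 r / delta)^beta >= 1], so the second summand times [r^beta] dominates the mass, which is at
   most 1. *)
exists (q + (2 / delta) `^ beta) => [|N X N2 minX p]; first exact: addr_gt0.
have N0 : 0 < N%:R :> R by rewrite ltr0n; case: N N2 {X minX}.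
have XE := minimiser_energy_fin d_ge1 W_loc W_sym WNy N2 minX.
have XF := (energy_fin WNy N2 X).1 XE.
have mass_le r i : 0 < r ->
    N%:R^-1 * (near_count X i r)%:R <= (q + (2 / delta) `^ beta) * r `^ beta.
  move=> r0; rewrite ler_pdivrMl//.
  have [rd|rd] := leP (2 * r) delta.
    apply: le_trans (count_le N X i r (XF i) _ r0 rd) _.
      by move=> y; exact: minimiser_potential_min.
    rewrite mulrA [N%:R * _]mulrC -!mulrA ler_wpM2r ?mulr_ge0 ?powR_ge0 ?(ltW N0)//.
    by rewrite lerDl ltW.
  apply: (@le_trans _ _ N%:R).
    by rewrite ler_nat (leq_trans (max_card _))// card_ord.
  rewrite ler_peMr ?(ltW N0)// mulrDl ler_wpDl ?mulr_ge0 ?powR_ge0 ?(ltW q0)//.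
  rewrite -powRM ?(ltW r0) ?divr_ge0 ?(ltW delta0)//.
  have {1}<- : 1 `^ beta = 1 :> R by rewrite powR1.
  apply: ge0_ler_powR; rewrite ?nnegrE ?(ltW beta0)//.
    by rewrite mulr_ge0 ?divr_ge0 ?(ltW r0) ?(ltW delta0).
  by rewrite mulrAC ler_pdivlMr// mul1r ltW.
rewrite /morrey /morrey_norm /p morrey_exponentE//; split.
  exists (q + (2 / delta) `^ beta); first exact: addr_gt0.
  by move=> r i r0; rewrite morrey_massE// lee_fin mass_le.
apply: ge_ereal_sup => _ [r [i [r0 ->]]].
rewrite morrey_massE// -EFinM lee_fin powRN ler_pdivrMl ?powR_gt0//.
by rewrite [leRHS]mulrC mass_le.
Qed.
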